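(* Let $T:E\to F$ be an order bounded almost weak Dunford-Pettis operator between Banach lattices. Then: (1) For all relatively weakly compact sets $A\subset E$, $B\subset F'$ and every $\varepsilon>0$ there exists $u\in E^+$ such that $|f|\big(T(|x|-u)^+\big)\le\varepsilon$ for all $x\in A$ and all $f\in B$. (2) For all relatively weakly compact sets $A\subset E$, $B\subset F'$ and every $\varepsilon>0$ there exists $g\in (F')^+$ such that $(|f|-g)^+\big(T|x|\big)\le\varepsilon$ for all $x\in A$ and all $f\in B$.
   Context: An operator is order bounded if it maps order bounded sets to order bounded sets. $T$ is almost weak Dunford-Pettis if $f_n(Tx_n)\to0$ whenever $(x_n)\subset E$ and $(f_n)\subset F'$ are disjoint weakly null sequences (disjoint meaning $|x_n|\wedge|x_m|=0$ for $n\neq m$). *)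

(* Defs.v *)
From HB Require Import structures.
From mathcomp Require Import all_boot all_order all_algebra.
From mathcomp Require Import all_classical all_reals all_analysis.
Set Implicit Arguments. Unset Strict Implicit. Unset Printing Implicit Defensive.
Import Order.TTheory GRing.Theory Num.Theory.
Import numFieldNormedType.Exports.
Local Open Scope classical_set_scope.
Local Open Scope ring_scope.

Section VectorLattice.
Context {R : realType} {E : normedModType R}.
(* A (Banach) lattice structure on E is given by its join operation [j];
   the order is  x <= y  iff  j x y = y. *)
Variable j : E -> E -> E.

Definition vle (x y : E) : Prop := j x y = y.
Definition vmeet (x y : E) : E := - j (- x) (- y).
Definition vabs (x : E) : E := j x (- x).
Definition vpos (x : E) : E := j x 0.

(* E (a complete normed space) is a Banach lattice for the join [j]:
   j is a semilattice join (hence the order vle is a lattice order with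
   joins j), the order is compatible with the vector structure, and the
   norm is a lattice norm. *)
Record banach_lattice : Prop := {
  bl_joinC : forall x y, j x y = j y x;
  bl_joinA : forall x y z, j x (j y z) = j (j x y) z;
  bl_joinxx : forall x, j x x = x;
  bl_joinD : forall x y z, x + j y z = j (x + y) (x + z);
  bl_joinZ : forall (a : R) y z, 0 < a -> a *: j y z = j (a *: y) (a *: z);
  bl_norm : forall x y, vle (vabs x) (vabs y) -> `|x| <= `|y| }.

Definition order_bounded_set (S : set E) : Prop :=
  exists a b, forall x, S x -> vle a x /\ vle x b.

Definition disjoint_seq (x : nat -> E) : Prop :=
  forall n m, n <> m -> vmeet (vabs (x n)) (vabs (x m)) = 0.
End VectorLattice.

Definition order_bounded_op {R : realType} {E F : normedModType R}
  (jE : E -> E -> E) (jF : F -> F -> F) (T : E -> F) : Prop :=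
  forall S : set E, order_bounded_set jE S -> order_bounded_set jF (T @` S).

Section Duality.
Context {R : realType}.

Definition dual_set (E : normedModType R) : set (E -> R) :=
  [set f | (forall (a : R) (x y : E), f (a *: x + y) = a * f x + f y)
           /\ continuous f].

Arguments dual_set : clear implicits.
Definition dualT (E : normedModType R) := {f : E -> R | dual_set E f}.

Definition dnorm (E : normedModType R) (f : dualT E) : R :=
  sup [set `|sval f x| | x in [set x : E | `|x| <= 1]].

Definition bidual_set (E : normedModType R) : set (dualT E -> R) :=
  [set phi | (forall (a : R) (f g h : dualT E),
                (forall y, sval h y = a * sval f y + sval g y) ->
                phi h = a * phi f + phi g)
             /\ exists C : R, forall f, `|phi f| <= C * dnorm f].
Arguments bidual_set : clear implicits.

Definition weak_top (X : Type) (Phi : set (X -> R)) :=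
  initial_topology (fun x : {classic X} =>
    ((fun phi : {phi | Phi phi} => sval phi x) : {ptws {phi | Phi phi} -> R})).

(* relatively compact for sigma(X, Phi): the closure is compact *)
Definition rel_weak_compact (X : Type) (Phi : set (X -> R)) (A : set X) : Prop :=
  precompact (A : set (weak_top Phi)).

Definition rwc_E (E : normedModType R) (A : set E) := rel_weak_compact (dual_set E) A.
Definition rwc_dual (E : normedModType R) (B : set (dualT E)) :=
  rel_weak_compact (bidual_set E) B.

Definition weakly_null (E : normedModType R) (x : nat -> E) : Prop :=
  forall phi, dual_set E phi -> (fun n => phi (x n)) @ \oo --> (0 : R).
Definition weakly_null_dual (E : normedModType R) (f : nat -> dualT E) : Prop :=
  forall psi, bidual_set E psi -> (fun n => psi (f n)) @ \oo --> (0 : R).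

Context {F : normedModType R} (j : F -> F -> F).
Definition dle (p q : F -> R) : Prop := forall y, vle j 0 y -> p y <= q y.
Definition is_dsup (p q h : F -> R) : Prop :=
  dual_set F h /\ dle p h /\ dle q h /\
  forall k, dual_set F k -> dle p k -> dle q k -> dle h k.
Definition is_dinf (p q h : F -> R) : Prop :=
  dual_set F h /\ dle h p /\ dle h q /\
  forall k, dual_set F k -> dle k p -> dle k q -> dle k h.
Definition is_dabs (f a : F -> R) : Prop := is_dsup f (fun y => - f y) a.
Definition disjoint_dual_seq (f : nat -> dualT F) : Prop :=
  forall n m, n <> m -> exists a b, is_dabs (sval (f n)) a /\
     is_dabs (sval (f m)) b /\ is_dinf a b (fun _ => 0).
End Duality.

Definition almost_weak_DP {R : realType} {E F : normedModType R}
  (jE : E -> E -> E) (jF : F -> F -> F) (T : E -> F) : Prop :=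
  forall (x : nat -> E) (f : nat -> dualT F),
    disjoint_seq jE x -> weakly_null x ->
    disjoint_dual_seq jF f -> weakly_null_dual f ->
    (fun n => sval (f n) (T (x n))) @ \oo --> (0 : R).

(* Main.v *)
Require Import Defs.
From HB Require Import structures.
From mathcomp Require Import all_boot all_order all_algebra.
From mathcomp Require Import all_classical all_reals all_analysis.
From mathcomp Require Import ring lra zify.
Set Implicit Arguments. Unset Strict Implicit. Unset Printing Implicit Defensive.
Import Order.TTheory GRing.Theory Num.Theory.
Import numFieldNormedType.Exports.
Local Open Scope classical_set_scope.
Local Open Scope ring_scope.

(** Both parts are one statement about the bilinear form [beta x f = f (T x)] on
    the Banach lattices E and F', read in the two orders of the variables.  If it
    fails, one picks inductively [a_n] in A and [b_n] in B such that [|b_n|] is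
    larger than [eps] on [T (|a_n| - 16^n sum_(i<n) |a_i|)^+].  Subtracting a
    small multiple of [y >= 2^-n |a_n|] makes the positive parts disjoint; a
    subsequence along which the earlier [|b_i|] are negligible allows the same
    disjointification on the side of F', and this contradicts the almost weak
    Dunford-Pettis property.  The remainders are controlled because order
    boundedness of T gives [|beta|] a majorant in each variable.

    Disjoint sequences below a relatively weakly compact set are weakly null: the
    components of a positive functional carried by the terms of the sequence are
    summable, hence map the set to a relatively weakly compact subset of l^1,
    where Schur's gliding hump applies.  The same argument, with norming
    functionals from Hahn-Banach, shows that such sets are norm bounded, which
    provides [y]. *)

(** * Riesz spaces *)

(** The modulus of T may not exist, since F need not be Dedekind complete; the two domination
    properties of the bilinear form replace it. For a positive functional h on F the map v -> h |T
    v| is only subadditive, but it has an additive majorant on the cone of E, and positive linear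
    forms on a Banach lattice are continuous. In the other variable, evaluation at an upper bound of
    |T r|, r in an order interval, is enough.

    The bases 16, 8 and 2 obey two constraints. Disjointness of the terms m < n needs 8^-m 2^-n >=
    16^-n, hence 16 = 8 * 2. The subtracted 8^-n y is paired with |b_n|, which is only known to be
    below 2^n times a fixed functional, so 8^-n 2^n must tend to 0.

    The second disjointification cannot use the original sequence, because nothing bounds the
    pairing with 16^n times the sum of the earlier |b_i|. Along a subsequence this sum is fixed
    before the next index is chosen, and the disjoint sequence in E, being weakly null, makes the
    pairing small. *)

Section Riesz.
Context {R : realType} {V : lmodType R}.
Variable j : V -> V -> V.

(** The norm-free part of [banach_lattice], over an [lmodType], so that the same lemmas serve E and
    [dualT F], which gets a vector space structure and a lattice below but no normed module
    structure. *)
Record riesz : Prop := {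
  rz_joinC : forall x y, j x y = j y x;
  rz_joinA : forall x y z, j x (j y z) = j (j x y) z;
  rz_joinxx : forall x, j x x = x;
  rz_joinD : forall x y z, x + j y z = j (x + y) (x + z);
  rz_joinZ : forall (a : R) y z, 0 < a -> a *: j y z = j (a *: y) (a *: z) }.

Definition rle (x y : V) : Prop := j x y = y.
Definition rmeet (x y : V) : V := - j (- x) (- y).
Definition rabs (x : V) : V := j x (- x).
Definition rpos (x : V) : V := j x 0.
Definition rdisj (x : nat -> V) := forall n m, n <> m -> rmeet (x n) (x m) = 0.

Hypothesis H : riesz.
Local Notation "x <<= y" := (rle x y) (at level 70).

Lemma rle_refl x : x <<= x. Proof. exact: rz_joinxx. Qed.

Lemma rle_anti x y : x <<= y -> y <<= x -> x = y.
Proof. by rewrite /rle => xy <-; rewrite (rz_joinC H). Qed.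

Lemma rle_trans y x z : x <<= y -> y <<= z -> x <<= z.
Proof. by rewrite /rle => xy yz; rewrite -yz (rz_joinA H) xy. Qed.

Lemma rle_joinl x y : x <<= j x y.
Proof. by rewrite /rle (rz_joinA H) (rz_joinxx H). Qed.

Lemma rle_joinr x y : y <<= j x y.
Proof. by rewrite (rz_joinC H); exact: rle_joinl. Qed.

Lemma rle_join x y z : x <<= z -> y <<= z -> j x y <<= z.
Proof. by rewrite /rle => xz yz; rewrite -(rz_joinA H) yz. Qed.

Lemma rleD2l z x y : x <<= y -> z + x <<= z + y.
Proof. by rewrite /rle -(rz_joinD H) => ->. Qed.

Lemma rleD2r z x y : x <<= y -> x + z <<= y + z.
Proof. by rewrite ![_ + z]addrC; exact: rleD2l. Qed.

Lemma rleD x y z t : x <<= y -> z <<= t -> x + z <<= y + t.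
Proof. by move=> /(rleD2r z) a /(rleD2l y); exact: rle_trans. Qed.

Lemma rsub_ge0 x y : 0 <<= y - x <-> x <<= y.
Proof.
split=> [/(rleD2r x)|/(rleD2r (- x))]; first by rewrite add0r subrK.
by rewrite subrr.
Qed.

Lemma rleBl x y z : x <<= y + z -> x - y <<= z.
Proof. by move=> /(rleD2r (- y)); rewrite addrAC subrr add0r. Qed.

Lemma rleN x y : x <<= y -> - y <<= - x.
Proof. by move=> /rsub_ge0; rewrite addrC -{1}[y]opprK => /rsub_ge0. Qed.

Lemma raddr_ge0 x y : 0 <<= x -> 0 <<= y -> 0 <<= x + y.
Proof. by move=> a /(rleD a); rewrite addr0. Qed.

Lemma rleZ (a : R) x y : 0 <= a -> x <<= y -> a *: x <<= a *: y.
Proof.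
rewrite le_eqVlt => /predU1P[<-|a0]; first by rewrite !scale0r => _; exact: rle_refl.
by rewrite /rle -(rz_joinZ H) // => ->.
Qed.

Lemma rscale_ge0 (a : R) x : 0 <= a -> 0 <<= x -> 0 <<= a *: x.
Proof. by move=> a0 /(rleZ a0); rewrite scaler0. Qed.

Lemma rleZl (a b : R) x : a <= b -> 0 <<= x -> a *: x <<= b *: x.
Proof. by move=> ab x0; apply/rsub_ge0; rewrite -scalerBl; apply: rscale_ge0 => //; lra. Qed.

Lemma rle_subr x y : 0 <<= y -> x - y <<= x.
Proof. by move=> y0; apply: rleBl; rewrite -{1}[x]add0r; exact: rleD2r. Qed.

Lemma rle_meet x y z : z <<= x -> z <<= y -> z <<= rmeet x y.
Proof.
move=> zx zy; rewrite -[z]opprK; apply: rleN.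
by apply: rle_join; exact: rleN.
Qed.

Lemma rmeet_lel x y : rmeet x y <<= x.
Proof. by rewrite -[X in _ <<= X]opprK; apply: rleN; exact: rle_joinl. Qed.

Lemma rmeetC x y : rmeet x y = rmeet y x.
Proof. by rewrite /rmeet (rz_joinC H). Qed.

Lemma rmeet_ler x y : rmeet x y <<= y.
Proof. by rewrite rmeetC; exact: rmeet_lel. Qed.

Lemma rmeet_ge0 x y : 0 <<= x -> 0 <<= y -> 0 <<= rmeet x y.
Proof. exact: rle_meet. Qed.

Lemma rle_meet2 x y z t : x <<= z -> y <<= t -> rmeet x y <<= rmeet z t.
Proof.
move=> xz yt; apply: rle_meet.
- exact: rle_trans (rmeet_lel _ _) xz.
- exact: rle_trans (rmeet_ler _ _) yt.
Qed.

Lemma rmeet0_le x y z t : 0 <<= x -> 0 <<= y -> x <<= z -> y <<= t ->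
  rmeet z t = 0 -> rmeet x y = 0.
Proof.
move=> x0 y0 xz yt zt; apply: rle_anti; last exact: rmeet_ge0.
by rewrite -zt; exact: rle_meet2.
Qed.

Lemma rmeetZ (a : R) x y : 0 < a -> rmeet (a *: x) (a *: y) = a *: rmeet x y.
Proof. by move=> a0; rewrite /rmeet -!scalerN -(rz_joinZ H) ?scalerN. Qed.

Lemma rmeet0Z (a b : R) x y : 0 <= a -> 0 <= b -> 0 <<= x -> 0 <<= y ->
  rmeet x y = 0 -> rmeet (a *: x) (b *: y) = 0.
Proof.
move=> a0 b0 x0 y0 xy.
(* The factor 1 + a + b dominates both scalars and is positive even when they vanish, as [rmeetZ]
   requires. *)
apply: (@rmeet0_le _ _ ((1 + a + b) *: x) ((1 + a + b) *: y)).
- exact: rscale_ge0.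
- exact: rscale_ge0.
- by apply: rleZl => //; lra.
- by apply: rleZl => //; lra.
- by rewrite rmeetZ ?xy ?scaler0 //; lra.
Qed.

Lemma rpos_ge0 x : 0 <<= rpos x. Proof. exact: rle_joinr. Qed.

Lemma rpos_ge x : x <<= rpos x. Proof. exact: rle_joinl. Qed.

Lemma rpos_le x z : x <<= z -> 0 <<= z -> rpos x <<= z. Proof. exact: rle_join. Qed.

Lemma rle_rpos x y : x <<= y -> rpos x <<= rpos y.
Proof. by move=> xy; apply: rpos_le (rpos_ge0 _); exact: rle_trans (rpos_ge _). Qed.

Lemma rposZ (a : R) x : 0 < a -> rpos (a *: x) = a *: rpos x.
Proof. by move=> a0; rewrite /rpos (rz_joinZ H) // scaler0. Qed.

Lemma rposB x : rpos x - rpos (- x) = x.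
Proof.
apply/eqP; rewrite subr_eq; apply/eqP.
by rewrite /rpos (rz_joinD H) subrr addr0 (rz_joinC H).
Qed.

Lemma rmeetB x y : x - rmeet x y = rpos (x - y).
Proof. by rewrite /rmeet opprK (rz_joinD H) subrr (rz_joinC H). Qed.

Lemma rjoinDmeet x y : j x y + rmeet x y = x + y.
Proof.
apply/eqP; rewrite -[X in _ + X]opprK subr_eq; apply/eqP.
rewrite /rmeet opprK (rz_joinD H) addrK.
by rewrite [x + y]addrC addrK (rz_joinC H).
Qed.

Lemma rmeet_posN x : rmeet (rpos x) (rpos (- x)) = 0.
Proof.
have := rmeetB (rpos x) (rpos (- x)); rewrite rposB => /eqP.
by rewrite subr_eq addrC -subr_eq subrr => /eqP.
Qed.

Lemma rabsE x : rabs x = rpos x + rpos (- x).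
Proof.
rewrite -rjoinDmeet rmeet_posN addr0; apply: rle_anti.
  apply: rle_join.
  - exact: rle_trans (rpos_ge _) (rle_joinl _ _).
  - exact: rle_trans (rpos_ge _) (rle_joinr _ _).
have p : 0 <<= rabs x.
  suff : 0 <<= 2 *: rabs x.
    move=> /(@rleZ (2^-1)); rewrite scaler0 scalerA mulVf ?scale1r //; apply.
    by rewrite invr_ge0.
  rewrite -[0](subrr x) [2]mulr2n scalerDl scale1r.
  by apply: rleD; [exact: rle_joinl|exact: rle_joinr].
by apply: rle_join; apply: rpos_le => //; [exact: rle_joinl|exact: rle_joinr].
Qed.

Lemma rabs_ge0 x : 0 <<= rabs x.
Proof. by rewrite rabsE; apply: raddr_ge0; exact: rpos_ge0. Qed.

Lemma rabs_ge x : x <<= rabs x. Proof. exact: rle_joinl. Qed.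

Lemma rabs_geN x : - x <<= rabs x. Proof. exact: rle_joinr. Qed.

Lemma rabs_le x z : x <<= z -> - x <<= z -> rabs x <<= z. Proof. exact: rle_join. Qed.

Lemma rabsN x : rabs (- x) = rabs x.
Proof. by rewrite /rabs opprK (rz_joinC H). Qed.

Lemma rabs_id x : 0 <<= x -> rabs x = x.
Proof.
move=> x0; apply: rle_anti (rabs_ge _); apply: rabs_le; first exact: rle_refl.
by apply: rle_trans (x0); rewrite -[0]oppr0; exact: rleN.
Qed.

Lemma rabsD x y : rabs (x + y) <<= rabs x + rabs y.
Proof.
apply: rabs_le; first by apply: rleD; exact: rabs_ge.
by rewrite opprD; apply: rleD; exact: rabs_geN.
Qed.

(** Riesz decomposition property, with x1 the meet of x and y; the rest is then (x - y)^+, which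
    stays below z. *)
Lemma riesz_decomp x y z : 0 <<= x -> 0 <<= y -> 0 <<= z -> x <<= y + z ->
  exists x1 x2, [/\ x = x1 + x2, 0 <<= x1, x1 <<= y, 0 <<= x2 & x2 <<= z].
Proof.
move=> x0 y0 z0 xyz; exists (rmeet x y), (x - rmeet x y); split.
- by rewrite addrC subrK.
- exact: rmeet_ge0.
- exact: rmeet_ler.
- by apply/rsub_ge0; exact: rmeet_lel.
- by rewrite rmeetB; apply: rpos_le => //; exact: rleBl.
Qed.

(** Decompose the meet along x + y: both pieces are positive, hence also below the meet itself and
    so below u. *)
Lemma rmeet_subadd x y u : 0 <<= x -> 0 <<= y -> 0 <<= u ->
  rmeet (x + y) u <<= rmeet x u + rmeet y u.
Proof.
move=> x0 y0 u0; have xy0 := raddr_ge0 x0 y0.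
have [|z1 [z2 [e z10 z1x z20 z2y]]] := riesz_decomp (rmeet_ge0 xy0 u0) x0 y0.
  exact: rmeet_lel.
have zu := rmeet_ler (x + y) u; rewrite e in zu *.
apply: rleD; apply: rle_meet => //; apply: rle_trans zu.
- by rewrite -{1}[z1]addr0; exact: rleD2l.
- by rewrite -{1}[z2]add0r; exact: rleD2r.
Qed.

Lemma rsum_ge0 n (x : nat -> V) : (forall i, (i < n)%N -> 0 <<= x i) ->
  0 <<= \sum_(i < n) x i.
Proof.
elim: n => [_|n IH h]; first by rewrite big_ord0; exact: rle_refl.
rewrite big_ord_recr; apply: raddr_ge0; last exact: h.
by apply: IH => i /ltnW; exact: h.
Qed.

Lemma rle_sum n (x : nat -> V) i : (forall i, 0 <<= x i) -> (i < n)%N ->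
  x i <<= \sum_(k < n) x k.
Proof.
move=> h; elim: n => // n IH; rewrite big_ord_recr /= ltnS leq_eqVlt => /predU1P[->|].
  by rewrite -{1}[x n]add0r; apply: rleD2r; apply: rsum_ge0 => k _.
by move=> /IH; rewrite -{2}[x i]addr0 => /rleD; apply.
Qed.

(* Disjointness turns the sum into a join. *)
Lemma rsum_disj n (x : nat -> V) z : (forall i, 0 <<= x i) -> rdisj x ->
  (forall i, x i <<= z) -> 0 <<= z -> \sum_(i < n) x i <<= z.
Proof.
move=> x0 xd xz z0; elim: n => [|n IH]; first by rewrite big_ord0.
suff m0 : rmeet (\sum_(i < n) x i) (x n) = 0.
  by rewrite big_ord_recr /= -rjoinDmeet m0 addr0; exact: rle_join.
suff : forall k, (k <= n)%N -> rmeet (\sum_(i < k) x i) (x n) = 0 by apply.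
elim=> [_|k IHk kn].
  rewrite big_ord0; apply: rle_anti; first exact: rmeet_lel.
  by apply: rmeet_ge0 => //; exact: rle_refl.
rewrite big_ord_recr /=; apply: rle_anti; last first.
  by apply: rmeet_ge0 => //; apply: raddr_ge0 => //; exact: rsum_ge0.
apply: (rle_trans (rmeet_subadd _ _ _)) => //; first exact: rsum_ge0.
rewrite IHk ?(ltnW kn) // add0r xd; first exact: rle_refl.
by move=> e; rewrite e ltnn in kn.
Qed.

(** The large multiple of the earlier terms separates the n-th term from these; the small multiple
    of y separates it from all later ones. *)
Definition disjointify (x : nat -> V) (y : V) (n : nat) : V :=
  rpos (x n - 16 ^+ n *: \sum_(i < n) x i - (8 ^+ n)^-1 *: y).

Lemma disjointify_le x y n : (forall n, 0 <<= x n) -> 0 <<= y -> disjointify x y n <<= x n.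
Proof.
move=> x0 y0; apply: rpos_le => //.
apply: (@rle_trans (x n - 16 ^+ n *: \sum_(i < n) x i)).
  by apply: rle_subr; apply: rscale_ge0 => //; rewrite invr_ge0 exprn_ge0.
by apply: rle_subr; apply: rscale_ge0; rewrite ?exprn_ge0 //; exact: rsum_ge0.
Qed.

(** For m < n and c = 16^-n, the m-th term lies below (x_m - c x_n)^+, because 8^-m y >= 8^-m 2^-n
    x_n >= c x_n. The n-th lies below (x_n - 16^n x_m)^+ = 16^n (x_m - c x_n)^-. Positive and
    negative parts of one element are disjoint. *)
Lemma disjointify_disj x y : (forall n, 0 <<= x n) ->
  (forall n, (2 ^+ n)^-1 *: x n <<= y) -> rdisj (disjointify x y).
Proof.
move=> x0 xy.
have y0 : 0 <<= y by apply: rle_trans (xy 0%N); rewrite expr0 invr1 scale1r.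
suff K m n : (m < n)%N -> rmeet (disjointify x y m) (disjointify x y n) = 0.
  move=> n m /eqP; rewrite neq_lt => /orP[] /K //.
  by rewrite rmeetC.
move=> mn; set c : R := (16 ^+ n)^-1.
have c0 : 0 < c by rewrite invr_gt0 exprn_gt0.
have c0' := ltW c0.
apply: (@rmeet0_le _ _ (rpos (x m - c *: x n)) (16 ^+ n *: rpos (- (x m - c *: x n)))).
- exact: rpos_ge0.
- exact: rpos_ge0.
- apply: rle_rpos; rewrite -addrA; apply: rleD2l; rewrite -opprD; apply: rleN.
  apply: (@rle_trans ((8 ^+ m)^-1 *: y)); last first.
    rewrite -{1}[_ *: y]add0r; apply: rleD2r.
    by apply: rscale_ge0; rewrite ?exprn_ge0 //; exact: rsum_ge0.
  have h8 : 0 <= (8 ^+ m)^-1 :> R by rewrite invr_ge0 exprn_ge0.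
  apply: rle_trans (rleZ h8 (xy n)); rewrite scalerA; apply: rleZl => //.
  rewrite /c -invfM lef_pV2 ?posrE ?mulr_gt0 ?exprn_gt0 //.
  rewrite (_ : 16 = 8 * 2 :> R); last by lra.
  by rewrite exprMn ler_pM2r ?exprn_gt0 // ler_weXn2l ?(ltnW mn) //; lra.
- rewrite -rposZ ?exprn_gt0 //; apply: rle_rpos.
  rewrite scalerN scalerBr opprB scalerA divff ?expf_neq0 // scale1r.
  apply: rle_trans; first apply: rle_subr.
    by apply: rscale_ge0 => //; rewrite invr_ge0 exprn_ge0.
  apply: rleD2l; apply: rleN; apply: rleZ; rewrite ?exprn_ge0 //.
  exact: rle_sum.
- rewrite -[rpos (x m - _)]scale1r; apply: rmeet0Z; rewrite ?exprn_ge0 //;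
    try exact: rpos_ge0.
  exact: rmeet_posN.
Qed.

End Riesz.

(** * Linear forms on Riesz spaces *)

Section LinearForms.
Context {R : realType} {V : lmodType R}.

Definition linform (f : V -> R) : Prop :=
  forall (a : R) x y, f (a *: x + y) = a * f x + f y.

Variable f : V -> R.
Hypothesis lf : linform f.

Lemma linform0 : f 0 = 0.
Proof. by have := lf 1 0 0; rewrite scale1r addr0 mul1r; lra. Qed.

Lemma linformD x y : f (x + y) = f x + f y.
Proof. by rewrite -[x]scale1r lf mul1r scale1r. Qed.

Lemma linformZ a x : f (a *: x) = a * f x.
Proof. by rewrite -[a *: x]addr0 lf linform0 addr0. Qed.

Lemma linformN x : f (- x) = - f x.
Proof. by rewrite -scaleN1r linformZ mulN1r. Qed.

Lemma linformB x y : f (x - y) = f x - f y.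
Proof. by rewrite linformD linformN. Qed.

Lemma linform_sum n (x : nat -> V) : f (\sum_(i < n) x i) = \sum_(i < n) f (x i).
Proof.
elim: n => [|n IH]; first by rewrite !big_ord0 linform0.
by rewrite !big_ord_recr linformD IH.
Qed.

End LinearForms.

Section RieszForms.
Context {R : realType} {V : lmodType R}.
Variable j : V -> V -> V.
Hypothesis H : riesz j.
Local Notation "x <<= y" := (rle j x y) (at level 70).

Definition posform (f : V -> R) : Prop := forall x, 0 <<= x -> 0 <= f x.

Lemma posform_le f x y : linform f -> posform f -> x <<= y -> f x <= f y.
Proof. by move=> lf pf /(rsub_ge0 H)/pf; rewrite linformB //; lra. Qed.

Lemma posform_abs f x : linform f -> posform f -> `|f x| <= f (rabs j x).
Proof.
move=> lf pf; rewrite ler_norml.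
have := posform_le lf pf (rabs_ge H x); have := posform_le lf pf (rabs_geN H x).
by rewrite linformN //; lra.
Qed.

Lemma extend_cone (p : V -> R) :
  (forall x y, 0 <<= x -> 0 <<= y -> p (x + y) = p x + p y) ->
  (forall (a : R) x, 0 < a -> 0 <<= x -> p (a *: x) = a * p x) ->
  exists g, linform g /\ forall x, 0 <<= x -> g x = p x.
Proof.
move=> pD pZ.
have p0 : p 0 = 0.
  by have := pD 0 0 (rle_refl H 0) (rle_refl H 0); rewrite addr0; lra.
have pZ' a x : 0 <= a -> 0 <<= x -> p (a *: x) = a * p x.
  rewrite le_eqVlt => /predU1P[<-|]; last exact: pZ.
  by rewrite scale0r mul0r.
pose g x := p (rpos j x) - p (rpos j (- x)).
(* The value does not depend on how an element is written as a difference of positive ones. This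
   reduces linearity to additivity on the cone; a negative scalar exchanges the two parts. *)
have gE a b : 0 <<= a -> 0 <<= b -> g (a - b) = p a - p b.
  move=> a0 b0; have e : rpos j (a - b) + b = a + rpos j (- (a - b)).
    by have/eqP := rposB H (a - b); rewrite subr_eq => /eqP {1}->; rewrite addrAC subrK.
  have := pD _ _ (rpos_ge0 H (a - b)) b0; rewrite e pD //; [rewrite /g; lra|exact: rpos_ge0].
exists g; split; last first.
  by move=> x x0; rewrite -[x]subr0 gE ?p0 ?subr0 //; exact: rle_refl.
move=> a x y.
have x1 := rpos_ge0 H x; have x2 := rpos_ge0 H (- x).
have y1 := rpos_ge0 H y; have y2 := rpos_ge0 H (- y).
have [a0|a0] := leP 0 a.
  have -> : a *: x + y = (a *: rpos j x + rpos j y) - (a *: rpos j (- x) + rpos j (- y)).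
    by rewrite opprD addrACA -scalerBr !(rposB H).
  have ax1 := rscale_ge0 H a0 x1; have ax2 := rscale_ge0 H a0 x2.
  rewrite gE; [|exact: raddr_ge0|exact: raddr_ge0].
  by rewrite !pD // !pZ' // /g; ring.
have a1 : 0 <= - a by lra.
have -> : a *: x + y = (- a *: rpos j (- x) + rpos j y) - (- a *: rpos j x + rpos j (- y)).
  by rewrite opprD addrACA -scalerBr -[X in - a *: X]opprB (rposB H) scalerN scaleNr opprK (rposB H).
have ax1 := rscale_ge0 H a1 x1; have ax2 := rscale_ge0 H a1 x2.
rewrite gE; [|exact: raddr_ge0|exact: raddr_ge0].
by rewrite !pD // !pZ' // /g; ring.
Qed.

(* The band component of [f] carried by [u]: [x |-> sup_c f (x /\ c u)]. *)
Lemma component f u : linform f -> posform f -> 0 <<= u -> exists g,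
  [/\ linform g, posform g, g u = f u,
      forall z, 0 <<= z -> rmeet j z u = 0 -> g z = 0 &
      forall x (e : R), 0 <<= x -> 0 < e ->
        exists2 c, 0 < c & g x < f (rmeet j x (c *: u)) + e].
Proof.
move=> lf pf u0.
pose S x := [set f (rmeet j x (c *: u)) | c in [set c : R | 0 < c]].
pose p x := sup (S x).
have cu c : 0 < c -> 0 <<= c *: u by move=> /ltW c0; exact: rscale_ge0.
have hsS x : 0 <<= x -> has_sup (S x).
  move=> x0; split; first by exists (f (rmeet j x (1 *: u))), 1 => //=.
  exists (f x) => _ [c _ <-]; apply: posform_le => //; exact: rmeet_lel.
have ub x c : 0 <<= x -> 0 < c -> f (rmeet j x (c *: u)) <= p x.
  by move=> x0 c0; apply: ub_le_sup; [exact: (hsS x x0).2|exists c].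
have lub x M : 0 <<= x -> (forall c, 0 < c -> f (rmeet j x (c *: u)) <= M) -> p x <= M.
  by move=> x0 h; apply: ge_sup; [exact: (hsS x x0).1|move=> _ [c c0 <-]; exact: h].
have adh x e : 0 <<= x -> 0 < e -> exists2 c, 0 < c & p x < f (rmeet j x (c *: u)) + e.
  move=> x0 e0; have [_ [c c0 <-] h] := sup_adherent e0 (hsS x x0).
  by exists c => //; rewrite -ltrBlDr.
have pD x y : 0 <<= x -> 0 <<= y -> p (x + y) = p x + p y.
  move=> x0 y0; have xy0 := raddr_ge0 H x0 y0; apply/eqP; rewrite eq_le; apply/andP; split.
    apply: lub => // c c0; apply: (@le_trans _ _ (f (rmeet j x (c *: u) + rmeet j y (c *: u)))).
      by apply: posform_le => //; apply: rmeet_subadd => //; exact: cu.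
    by rewrite linformD //; apply: lerD; exact: ub.
  apply/ler_addgt0Pr => e e0; have e20 : 0 < e / 2 by lra.
  have [c c0 hc] := adh x (e / 2) x0 e20; have [d d0 hd] := adh y (e / 2) y0 e20.
  (* Near-optimal multiples c for x and d for y combine into the multiple c + d for x + y. *)
  have cd0 : 0 < c + d by lra.
  have := ub _ _ xy0 cd0.
  suff : f (rmeet j x (c *: u)) + f (rmeet j y (d *: u)) <= f (rmeet j (x + y) ((c + d) *: u)) by lra.
  rewrite -linformD //; apply: posform_le => //; apply: (rle_meet H).
    by apply: rleD => //; exact: rmeet_lel.
  by rewrite scalerDl; apply: rleD => //; exact: rmeet_ler.
have pZl a x : 0 < a -> 0 <<= x -> p (a *: x) <= a * p x.
  move=> a0 x0; apply: lub => [|c c0]; first by apply: rscale_ge0 => //; lra.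
  have -> : c *: u = a *: ((c / a) *: u).
    by rewrite scalerA mulrC divfK // lt0r_neq0.
  rewrite rmeetZ // linformZ // ler_pM2l //; apply: ub => //; exact: divr_gt0.
have pZ a x : 0 < a -> 0 <<= x -> p (a *: x) = a * p x.
  move=> a0 x0; apply/eqP; rewrite eq_le pZl //=.
  have ax0 : 0 <<= a *: x by apply: rscale_ge0 => //; lra.
  have ai : 0 < a^-1 by rewrite invr_gt0.
  have := pZl _ _ ai ax0; rewrite scalerA mulVf ?lt0r_neq0 // scale1r.
  by rewrite ler_pdivlMl.
have [g [lg gp]] := extend_cone pD pZ.
exists g; split => //.
- move=> x x0; rewrite gp //; apply: le_trans (ub x 1 x0 ltr01); apply: pf.
  by apply: rmeet_ge0 => //; exact: cu.
- rewrite gp //; apply/eqP; rewrite eq_le; apply/andP; split.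
    by apply: lub => // c c0; apply: posform_le => //; exact: rmeet_lel.
  apply: le_trans (ub u 1 u0 ltr01); apply: posform_le => //.
  by rewrite scale1r; apply: rle_meet => //; exact: rle_refl.
- move=> z z0 zu; have s0 c : 0 < c -> rmeet j z (c *: u) = 0.
    by move=> /ltW c0; rewrite -[z]scale1r; exact: rmeet0Z.
  rewrite gp //; apply/eqP; rewrite eq_le; apply/andP; split.
    by apply: lub => // c c0; rewrite s0 // linform0.
  by rewrite -[X in X <= _](linform0 lf) -(s0 1 ltr01); exact: ub.
- by move=> x e x0 e0; rewrite gp //; exact: adh.
Qed.

(* Riesz-Kantorovich: the least additive majorant of [q] on the cone is the
   supremum of the sums of [q] over the finite positive partitions. *)
Lemma kantorovich (q M : V -> R) :
  (forall x y, 0 <<= x -> 0 <<= y -> q (x + y) <= q x + q y) ->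
  (forall (a : R) x, 0 < a -> 0 <<= x -> q (a *: x) = a * q x) ->
  (forall s : seq V, (forall x, x \in s -> 0 <<= x) ->
     \sum_(x <- s) q x <= M (\sum_(x <- s) x)) ->
  exists g, [/\ linform g, forall x, 0 <<= x -> q x <= g x,
    forall x, 0 <<= x -> g x <= M x &
    forall k, linform k -> (forall x, 0 <<= x -> q x <= k x) ->
      forall x, 0 <<= x -> g x <= k x].
Proof.
move=> qD qZ qM.
pose S v := [set r | exists s : seq V, [/\ forall x, x \in s -> 0 <<= x,
   \sum_(x <- s) x = v & r = \sum_(x <- s) q x]].
pose p v := sup (S v).
have S1 v : 0 <<= v -> S v (q v).
  by move=> v0; exists [:: v]; rewrite !big_seq1; split=> // x; rewrite inE => /eqP->.
have ubS v : ubound (S v) (M v) by move=> _ [s [s0 <- ->]]; exact: qM.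
have hsS v : 0 <<= v -> has_sup (S v).
  by move=> v0; split; [exists (q v); exact: S1|exists (M v)].
have ub v r : 0 <<= v -> S v r -> r <= p v.
  by move=> v0 h; apply: ub_le_sup => //; exact: (hsS v v0).2.
have lub v K : 0 <<= v -> (forall r, S v r -> r <= K) -> p v <= K.
  by move=> v0 h; apply: ge_sup; [exact: (hsS v v0).1|exact: h].
(* By Riesz decomposition a partition of v + w refines into one of v and one of w, and subadditivity
   of q lets the sum only grow. This is the hard half of the additivity of p. *)
have split_part (s : seq V) : (forall x, x \in s -> 0 <<= x) -> forall v w,
    0 <<= v -> 0 <<= w -> \sum_(x <- s) x = v + w ->
    exists a b, [/\ S v a, S w b & \sum_(x <- s) q x <= a + b].
  elim: s => [_ v w v0 w0|x s IH s0 v w v0 w0].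
    rewrite !big_nil => e.
    have v00 : v = 0.
      apply: (rle_anti H) v0; rewrite e -{1}[v]addr0; exact: rleD2l.
    have w00 : w = 0 by rewrite v00 add0r in e.
    rewrite v00 w00; exists 0, 0; rewrite addr0; split => //;
      by exists [::]; rewrite !big_nil; split.
  rewrite !big_cons => e.
  have sp y : y \in s -> 0 <<= y by move=> ys; apply: s0; rewrite inE ys orbT.
  have x0 : 0 <<= x by apply: s0; rewrite inE eqxx.
  have ss0 : 0 <<= \sum_(y <- s) y.
    rewrite big_seq; elim/big_ind: _ => //; [exact: rle_refl|exact: raddr_ge0].
  have [|x1 [x2 [ex x10 x1v x20 x2w]]] := riesz_decomp H x0 v0 w0.
    by rewrite -e -{1}[x]addr0; exact: rleD2l.
  have [||| a [b [[sa [sa0 sav ->]] [sb [sb0 sbw ->]] ab]]] := IH sp (v - x1) (w - x2).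
  - by apply/(rsub_ge0 H).
  - by apply/(rsub_ge0 H).
  - by apply/eqP; rewrite addrACA -opprD -ex -e addrC addKr.
  exists (\sum_(x <- x1 :: sa) q x), (\sum_(x <- x2 :: sb) q x); split.
  - exists (x1 :: sa); split=> //; first by move=> y; rewrite inE => /predU1P[->//|]; exact: sa0.
    by rewrite big_cons sav addrC subrK.
  - exists (x2 :: sb); split=> //; first by move=> y; rewrite inE => /predU1P[->//|]; exact: sb0.
    by rewrite big_cons sbw addrC subrK.
  - by rewrite !big_cons; have := qD _ _ x10 x20; rewrite -ex; lra.
have pD v w : 0 <<= v -> 0 <<= w -> p (v + w) = p v + p w.
  move=> v0 w0; have vw0 := raddr_ge0 H v0 w0; apply/eqP; rewrite eq_le; apply/andP; split.
    apply: lub => // _ [s [s0 sv ->]].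
    have [a [b [Sa Sb]]] := split_part s s0 v w v0 w0 sv.
    by have := ub _ _ v0 Sa; have := ub _ _ w0 Sb; lra.
  apply/ler_addgt0Pr => e e0; have e20 : 0 < e / 2 by lra.
  have [_ [sa [sa0 sav ->]] ha] := sup_adherent e20 (hsS v v0).
  have [_ [sb [sb0 sbw ->]] hb] := sup_adherent e20 (hsS w w0).
  have : \sum_(x <- sa ++ sb) q x <= p (v + w).
    apply: ub => //; exists (sa ++ sb); split => //; last by rewrite big_cat /= sav sbw.
    by move=> x; rewrite mem_cat => /orP[]; [exact: sa0|exact: sb0].
  by rewrite big_cat /=; rewrite -/(p v) -/(p w) in ha hb; lra.
have pZl a x : 0 < a -> 0 <<= x -> p (a *: x) <= a * p x.
  move=> a0 x0; apply: lub => [|_ [s [s0 sx ->]]]; first by apply: rscale_ge0 => //; lra.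
  have ai : 0 < a^-1 by rewrite invr_gt0.
  suff : \sum_(y <- map (fun y => a^-1 *: y) s) q y <= p x.
    rewrite big_map big_seq (eq_bigr (fun y => a^-1 * q y)) => [|y ys]; last by apply: qZ => //; exact: s0.
    by rewrite -big_seq -mulr_sumr ler_pdivrMl.
  apply: ub => //; exists (map (fun y => a^-1 *: y) s); split=> //.
    by move=> _ /mapP[y /s0 y0 ->]; apply: rscale_ge0 => //; lra.
  by rewrite big_map -scaler_sumr sx scalerA mulVf ?scale1r // lt0r_neq0.
have pZ a x : 0 < a -> 0 <<= x -> p (a *: x) = a * p x.
  move=> a0 x0; apply/eqP; rewrite eq_le pZl //=.
  have ax0 : 0 <<= a *: x by apply: rscale_ge0 => //; lra.
  have ai : 0 < a^-1 by rewrite invr_gt0.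
  have := pZl _ _ ai ax0; rewrite scalerA mulVf ?lt0r_neq0 // scale1r.
  by rewrite ler_pdivlMl.
have [g [lg gp]] := extend_cone pD pZ.
exists g; split=> // [x x0|x x0|k lk qk x x0]; rewrite gp //.
- by apply: ub => //; exact: S1.
- by apply: lub => // r; exact: ubS.
- apply: lub => // _ [s [s0 <- ->]].
  elim: s s0 => [_|y s IH s0]; first by rewrite !big_nil linform0.
  rewrite !big_cons linformD //; apply: lerD; first by apply: qk; apply: s0; rewrite inE eqxx.
  by apply: IH => z zs; apply: s0; rewrite inE zs orbT.
Qed.

(** [kantorovich] for q x = |f x|. With suitable signs, the sum of the |f x_i| over a partition is f
    z for z the sum of the +-x_i; since |z| is below the partitioned element, M bounds it. Taking M
    to be a multiple of the norm later makes the modulus continuous. *)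
Lemma modulus f (M : V -> R) : linform f ->
  (forall x v, rabs j x <<= v -> `|f x| <= M v) ->
  exists g, [/\ linform g, posform g, forall x, `|f x| <= g (rabs j x),
    forall x, 0 <<= x -> g x <= M x &
    forall k, linform k -> (forall x, 0 <<= x -> f x <= k x) ->
      (forall x, 0 <<= x -> - f x <= k x) -> forall x, 0 <<= x -> g x <= k x].
Proof.
move=> lf fM; have [|||g [lg fg gM gmin]] := @kantorovich (fun x => `|f x|) M.
- by move=> x y _ _; rewrite linformD //; exact: ler_normD.
- by move=> a x a0 _; rewrite linformZ // normrM gtr0_norm.
- move=> s s0.
  suff [z zs <-] : exists2 z, rabs j z <<= \sum_(x <- s) x & `|f z| = \sum_(x <- s) `|f x| by exact: fM.
  suff [z zs fz] : exists2 z, rabs j z <<= \sum_(x <- s) x & f z = \sum_(x <- s) `|f x|.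
    by exists z => //; rewrite fz ger0_norm // sumr_ge0.
  elim: s s0 => [_|x s IH s0].
    by exists 0; rewrite !big_nil ?linform0 // (rabs_id H) //; exact: rle_refl.
  have [|z zs fz] := IH; first by move=> y ys; apply: s0; rewrite inE ys orbT.
  have x0 : 0 <<= x by apply: s0; rewrite inE eqxx.
  rewrite !big_cons -fz; have [fx|fx] := ger0P (f x).
    exists (x + z); last by rewrite linformD.
    by apply: (rle_trans H (rabsD H _ _)); rewrite (rabs_id H) //; exact: rleD2l.
  exists (- x + z); last by rewrite linformD // linformN.
  by apply: (rle_trans H (rabsD H _ _)); rewrite (rabsN H) (rabs_id H) //; exact: rleD2l.
exists g; split=> //.
- by move=> x x0; exact: le_trans (fg x x0).
- move=> x; rewrite (rabsE H) linformD // -{1}(rposB H x) linformB //.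
  by apply: le_trans (ler_normB _ _) _; apply: lerD; apply: fg; exact: rpos_ge0.
- move=> k lk fk nfk; apply: gmin => // x x0; rewrite ler_norml; apply/andP; split.
    by rewrite lerNl; exact: nfk.
  exact: fk.
Qed.

End RieszForms.

(** * Weak cluster points and absolutely convergent sums *)

Section WeakCluster.
Context {R : realType} (X : Type) (Phi : set (X -> R)).

Lemma weak_top_continuous phi : Phi phi -> continuous (phi : weak_top Phi -> R).
Proof.
move=> hphi x.
have h := @initial_continuous {classic X} _ (fun x : {classic X} =>
    ((fun phi : {phi | Phi phi} => sval phi x) : {ptws {phi | Phi phi} -> R})) x.
exact: (continuous_comp h (@proj_continuous {classic {phi | Phi phi}} (fun=> R) (exist _ phi hphi) _)).
Qed.

(** Compactness is used only through cluster points: on any finite set of functionals, infinitely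
    many terms with index in D come close to x. Thus no convergent subsequence, and no
    Eberlein-Smulian theorem, is called for. *)
Lemma rwc_cluster (W : set X) (y : nat -> X) (D : nat -> Prop) :
  rel_weak_compact Phi W -> (forall n, exists2 k, (n <= k)%N & D k) ->
  (forall k, D k -> W (y k)) ->
  exists x, forall (phi : nat -> X -> R) N (e : R) n,
    (forall i, Phi (phi i)) -> 0 < e ->
    exists k, [/\ (n <= k)%N, D k &
      forall i, (i < N)%N -> `|phi i (y k) - phi i x| < e].
Proof.
rewrite /rel_weak_compact precompactE => cW Dinf DW.
pose Y : nat -> weak_top Phi := y.
pose B n := Y @` [set k | (n <= k)%N /\ D k].
pose F := filter_from setT B.
have FF : ProperFilter F.
  apply: filter_from_proper; last first.
    by move=> n _; have [k nk Dk] := Dinf n; exists (Y k), k.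
  apply: filter_from_filter; first by exists 0%N.
  move=> i k _ _; exists (maxn i k) => //; rewrite /B => _ [l [+ Dl] <-].
  by rewrite geq_max => /andP[il kl]; split; exists l.
have FW : F (closure (W : set (weak_top Phi))).
  by exists 0%N => // _ [k [_ Dk] <-]; apply: subset_closure; exact: DW.
have [x [_ clx]] := cW F FF FW; exists x => phi N e n hphi e0.
have hB : nbhs x [set z : weak_top Phi | forall i, (i < N)%N -> `|phi i z - phi i x| < e].
  elim: N => [|N IH]; first by apply: filterS filterT.
  have := @weak_top_continuous _ (hphi N) x.
  move=> /(@cvgr_dist_lt _ R) /(_ e e0) h.
  apply: filterS (filterI IH h) => z [hz hN] i.
  rewrite ltnS leq_eqVlt => /predU1P[->|]; last exact: hz.
  by rewrite distrC.
have hF : F (B n) by exists n.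
by have [_ [[k [nk Dk] <-] hk]] := clx _ _ hF hB; exists k; split.
Qed.

End WeakCluster.

Section RealSums.
Context {R : realType}.
Implicit Types u : nat -> R.

Definition tends0 u := forall e : R, 0 < e -> exists N, forall n, (N <= n)%N -> `|u n| <= e.

Definition sums_to u (l : R) := forall e : R, 0 < e ->
  exists N, forall n, (N <= n)%N -> `|l - \sum_(i < n) u i| <= e.

Lemma cvg_tends0 u : u @ \oo --> (0 : R) <-> tends0 u.
Proof.
split=> [/(@cvgr0_norm_le _ R) h e e0|h].
  by have [N _ hN] := h e e0; exists N.
apply/(@cvgr0Pnorm_le R R) => e e0; have [N hN] := h e e0.
by exists N.
Qed.

Lemma sum_norm_mono u n m : (n <= m)%N -> \sum_(i < n) `|u i| <= \sum_(i < m) `|u i|.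
Proof.
move=> /subnKC <-; elim: (m - n)%N => [|k IH]; first by rewrite addn0.
by rewrite addnS big_ord_recr /=; have := normr_ge0 (u (n + k)%N); lra.
Qed.

(** A tail estimate phrased with partial sums only; for n < N the difference is nonpositive. *)
Lemma sum_tail u (M : R) : (forall n, \sum_(i < n) `|u i| <= M) -> forall e : R, 0 < e ->
  exists N, forall n, \sum_(i < n) `|u i| - \sum_(i < N) `|u i| <= e.
Proof.
move=> hM e e0; pose S := range (fun n => \sum_(i < n) `|u i|).
have hS : has_sup S by split; [exists 0, 0%N => //; rewrite big_ord0|exists M => _ [n _ <-]].
have [_ [N _ <-] hN] := sup_adherent e0 hS; exists N => n.
have : \sum_(i < n) `|u i| <= sup S by apply: ub_le_sup; [exact: hS.2|exists n].
lra.
Qed.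

Lemma sums_to_ex u (M : R) : (forall n, \sum_(i < n) `|u i| <= M) ->
  exists2 l, `|l| <= M & sums_to u l.
Proof.
move=> hM.
have cn : cvgn [normed series u].
  apply: nondecreasing_is_cvgn.
    by move=> n m nm; rewrite /= !seriesEord; exact: sum_norm_mono.
  by exists M => _ [n _ <-] /=; rewrite seriesEord; exact: hM.
have c := normed_cvg cn; exists (limn (series u)).
  apply: (@le_trans _ _ (limn [normed series u])).
    exact: lim_series_norm.
  by apply: limr_le => //; near=> n; rewrite /= seriesEord; exact: hM.
move=> e e0; have /(@cvgr_dist_le _ R) /(_ e e0) [N _ hN] := c.
by exists N => n /hN; rewrite /= seriesEord.
Unshelve. all: by end_near. Qed.

Lemma sums_to_ge u l n : sums_to u l -> (forall i, 0 <= u i) -> u n <= l.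
Proof.
move=> h u0; apply/ler_addgt0Pr => e e0; have [N] := h e e0; move=> /(_ (maxn N n.+1)).
rewrite leq_maxl => /(_ isT); rewrite ler_norml => /andP[h1 _].
have : u n <= \sum_(i < maxn N n.+1) u i.
  have hn : (n < maxn N n.+1)%N by rewrite leq_maxr.
  rewrite (bigD1 (Ordinal hn)) //= lerDl; exact: sumr_ge0.
lra.
Qed.

End RealSums.

(** * Schur property *)

Section Schur.
Context {R : realType}.

Lemma sums_to_uniq (u : nat -> R) l m : sums_to u l -> sums_to u m -> l = m.
Proof.
move=> hl hm; apply/eqP; rewrite -subr_eq0 -normr_le0; apply/ler_addgt0Pr => e e0.
have e20 : 0 < e / 2 by lra.
have [N1 h1] := hl _ e20; have [N2 h2] := hm _ e20.
have := h1 _ (leq_maxl N1 N2); have := h2 _ (leq_maxr N1 N2).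
set s := \sum_(i < _) _; rewrite !ler_norml => /andP[a b] /andP[c d].
by apply/andP; split; lra.
Qed.

Lemma sums_to_lin (a : R) (u v : nat -> R) l m : sums_to u l -> sums_to v m ->
  sums_to (fun i => a * u i + v i) (a * l + m).
Proof.
move=> hl hm e e0; have a1 : 0 < `|a| + 1 by have := normr_ge0 a; lra.
have e20 : 0 < e / 2 by lra.
have e30 : 0 < e / 2 / (`|a| + 1) by exact: divr_gt0.
have [N1 h1] := hl _ e30; have [N2 h2] := hm _ e20.
exists (maxn N1 N2) => n; rewrite geq_max => /andP[/h1 {}h1 /h2 {}h2].
rewrite big_split /= -mulr_sumr.
set s := \sum_(i < _) u i in h1 *; set t := \sum_(i < _) v i in h2 *.
have -> : a * l + m - (a * s + t) = a * (l - s) + (m - t) by ring.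
apply: le_trans (ler_normD _ _) _; rewrite normrM.
suff : `|a| * `|l - s| <= e / 2 by lra.
rewrite ler_pdivlMr // in h1; apply: le_trans h1.
by rewrite mulrC ler_wpM2l //; lra.
Qed.

(** The mask S selects a subseries. These 0/1 combinations are the only elements of the dual of l^1
    that the gliding hump tests, and the bound by N places them in Phi. *)
Lemma linform_sums (V : lmodType R) (g : nat -> V -> R) (N : V -> R) (S : nat -> bool) :
  (forall i, linform (g i)) -> (forall n x, \sum_(i < n) `|g i x| <= N x) ->
  exists h, [/\ linform h, forall x, `|h x| <= N x &
    forall x, sums_to (fun i => if S i then g i x else 0) (h x)].
Proof.
move=> lg gN.
have H x : exists l, `|l| <= N x /\ sums_to (fun i => if S i then g i x else 0) l.
  have [|l h1 h2] := @sums_to_ex R (fun i => if S i then g i x else 0) (N x); last by exists l.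
  move=> n; apply: le_trans (gN n x); apply: ler_sum => i _.
  by case: (S i) => //; rewrite normr0.
have [h hh] := choice H.
exists h; split=> [a x y|x|x]; [|exact: (hh x).1|exact: (hh x).2].
apply: sums_to_uniq (hh _).2 _.
have := sums_to_lin a (hh x).2 (hh y).2.
congr sums_to; apply/funext => i; case: (S i); last by rewrite mulr0 addr0.
by rewrite lg.
Qed.

Lemma block_sum (d : nat -> R) (S : nat -> bool) a k b : (a <= k < b)%N -> S k ->
  (forall i, (a <= i < b)%N -> S i -> i = k) -> forall n, (b <= n)%N ->
  `|\sum_(i < n) (if S i then d i else 0) - d k| <=
     \sum_(i < a) `|d i| + (\sum_(i < n) `|d i| - \sum_(i < b) `|d i|).
Proof.
move=> /andP[ak kb] Sk Suniq.
(* The minimum and the maximum merge head, block and tail into one formula that an induction on n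
   can carry. *)
suff K n : `|\sum_(i < n) (if S i then d i else 0) - (if (k < n)%N then d k else 0)| <=
     \sum_(i < minn n a) `|d i| + (\sum_(i < maxn n b) `|d i| - \sum_(i < b) `|d i|).
  move=> n bn; have := K n; rewrite (leq_trans kb bn).
  by rewrite (minn_idPr _) ?(maxn_idPl _) //; lia.
elim: n => [|n IH].
  by rewrite big_ord0 ltn0 min0n max0n big_ord0 !subrr normr0 addr0.
rewrite big_ord_recr /=.
have [na|an] := ltnP n a.
  have -> : (k < n.+1)%N = false by lia.
  have kn : (k < n)%N = false by lia.
  have -> : minn n.+1 a = n.+1 by lia.
  move: IH; rewrite kn.
  have -> : minn n a = n by lia.
  have -> : maxn n b = b by lia.
  have -> : maxn n.+1 b = b by lia.
  rewrite big_ord_recr /= !subr0 subrr => IH; apply: le_trans (ler_normD _ _) _.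
  by case: (S n); have := normr_ge0 (d n); rewrite ?normr0; lra.
have ma : minn n.+1 a = minn n a by lia.
have [nb|bn] := ltnP n b.
  have -> : maxn n.+1 b = maxn n b by lia.
  rewrite ma; have [nk|nk] := eqVneq n k.
    move: IH; rewrite nk ltnn ltnSn Sk subr0 addrK => IH; exact: IH.
  have -> : S n = false by apply/negP => /(Suniq n) h; move/eqP: nk; apply; apply: h; lia.
  have -> : (k < n.+1)%N = (k < n)%N by lia.
  by rewrite addr0.
have -> : (k < n.+1)%N by lia.
rewrite ma; have kn : (k < n)%N by lia.
move: IH; rewrite kn.
have -> : maxn n b = n by lia.
have -> : maxn n.+1 b = n.+1 by lia.
rewrite big_ord_recr /= => IH; rewrite addrAC; apply: le_trans (ler_normD _ _) _.
by case: (S n); have := normr_ge0 (d n); rewrite ?normr0; lra.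
Qed.

(* The gliding-hump proof of Schur's theorem for the map [x |-> (g_i x)_i] into
   l^1. The cluster point [x'] of the extracted subsequence agrees with [x] on
   every [g_i], hence on every subseries, although nothing forces [x' = x]. *)
Lemma schur (V : lmodType R) (Phi : set (V -> R)) (W : set V)
    (g : nat -> V -> R) (N : V -> R) (y : nat -> V) :
  rel_weak_compact Phi W -> (forall i, linform (g i)) ->
  (forall n x, \sum_(i < n) `|g i x| <= N x) ->
  (forall h, linform h -> (forall x, `|h x| <= N x) -> Phi h) ->
  (forall i, W (y i)) -> tends0 (fun i => g i (y i)).
Proof.
move=> cW lg gN PhiN Wy e e0; apply: contrapT => /forallNP bad.
pose D k := e < `|g k (y k)|.
have Dinf n : exists2 k, (n <= k)%N & D k.
  have /existsNP[k /not_implyP[nk /negP]] := bad n.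
  by rewrite -ltNge => h; exists k.
have Phig i : Phi (g i).
  apply: PhiN => // x; apply: le_trans (gN i.+1 x).
  by rewrite big_ord_recr /= lerDr sumr_ge0.
have [x clx] := rwc_cluster cW Dinf (fun k _ => Wy k).
pose d k i := g i (y k) - g i x.
have e80 : 0 < e / 8 by lra.
(* One hump: an index k >= N0 at which d k is small on the head i < N0, and a cutoff after which its
   tail is small. Taking k >= K0 makes |g k x| at most e / 8, so that d k k stays above 7e / 8. The
   N0 head terms, each below e / 8 / (N0 + 1), add up to at most e / 8. *)
have step N0 : exists p : nat * nat, [/\ (N0 <= p.1 < p.2)%N, D p.1, `|g p.1 x| <= e / 8,
    forall i, (i < N0)%N -> `|d p.1 i| < e / 8 / N0.+1%:R &
    forall n, \sum_(i < n) `|d p.1 i| - \sum_(i < p.2) `|d p.1 i| <= e / 8].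
  have [K0 hK0] := @sum_tail R (fun i => g i x) _ (fun n => gN n x) _ e80.
  have eN : 0 < e / 8 / N0.+1%:R by rewrite divr_gt0.
  have [k [kge Dk hk]] := clx g N0 _ (maxn N0 K0) Phig eN.
  have dM n : \sum_(i < n) `|d k i| <= N (y k) + N x.
    apply: (@le_trans _ _ (\sum_(i < n) (`|g i (y k)| + `|g i x|))).
      by apply: ler_sum => i _; exact: ler_normB.
    by rewrite big_split /=; apply: lerD; exact: gN.
  have [N1 hN1] := @sum_tail R (d k) _ dM _ e80.
  exists (k, maxn k.+1 N1); split => //=.
  - by rewrite leq_maxl andbT; lia.
  - have := hK0 k.+1; rewrite big_ord_recr /=.
    have : \sum_(i < K0) `|g i x| <= \sum_(i < k) `|g i x| by apply: (@sum_norm_mono R (fun i => g i x)); lia.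
    lra.
  - move=> n; have := hN1 n; have := sum_norm_mono (d k) (leq_maxr k.+1 N1); lra.
have [P hP] := choice step.
pose Nj := fix F n := if n is m.+1 then (P (F m)).2 else 0%N.
pose kj n := (P (Nj n)).1.
have kjP n : (Nj n <= kj n < Nj n.+1)%N by case: (hP (Nj n)).
have NjS n : (Nj n < Nj n.+1)%N by have := kjP n; lia.
have Njm i n : (i <= n)%N -> (Nj i <= Nj n)%N.
  by elim: n => [|n IH]; [rewrite leqn0 => /eqP->|rewrite leq_eqVlt => /predU1P[->//|/IH]; have := NjS n; lia].
have Njge n : (n <= Nj n)%N by elim: n => // n IH; have := NjS n; lia.
pose S i := `[< exists n, i = kj n >].
have [h [lh hN hS]] := linform_sums S lg gN.
(* The hump is at least 7e / 8; head, tail and truncation of the series of h cost e / 8 each, which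
   leaves e / 2. *)
have far n : e / 2 <= `|h (y (kj n)) - h x|.
  have [_ Dk gk dk tk] := hP (Nj n); rewrite -/(kj n) in Dk gk dk tk.
  rewrite -linformB //; have [M hM] := hS (y (kj n) - x) _ e80.
  have := hM _ (leq_maxl M (Nj n.+1)).
  rewrite (eq_bigr (fun i : 'I_ _ => if S i then d (kj n) i else 0)); last first.
    by move=> i _; rewrite linformB.
  have Sk : S (kj n) by apply/asboolP; exists n.
  have Su i : (Nj n <= i < Nj n.+1)%N -> S i -> i = kj n.
    move=> hi /asboolP[m em]; have := kjP m; have := kjP n; rewrite -em => h1 h2.
    have [mn|nm|mn] := ltngtP m n; first by have := Njm _ _ mn; lia.
      by have := Njm _ _ nm; lia.
    by rewrite em mn.
  have := block_sum (d (kj n)) (kjP n) Sk Su (leq_maxr M (Nj n.+1)).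
  have := tk (maxn M (Nj n.+1)).
  have : \sum_(i < Nj n) `|d (kj n) i| <= e / 8.
    have nn : (Nj n)%:R < (Nj n).+1%:R :> R by rewrite ltr_nat.
    have n0 : 0 < (Nj n).+1%:R :> R by [].
    apply: (@le_trans _ _ (\sum_(i < Nj n) (e / 8 / (Nj n).+1%:R))).
      by apply: ler_sum => i _; apply/ltW; exact: dk.
    rewrite sumr_const card_ord -[X in X <= _]mulr_natr mulrAC.
    by rewrite ler_pdivrMr // ler_pM2l // ltW.
  set A := \sum_(i < _) _; set B := \sum_(i < maxn _ _) _; set C := \sum_(i < Nj n.+1) _.
  set E := \sum_(i < maxn _ _) _ => hA hB h1 h2.
  have hd : e - e / 8 <= `|d (kj n) (kj n)|.
    by have := lerB_normD (g (kj n) (y (kj n))) (- g (kj n) x); rewrite normrN /d; rewrite /D in Dk; lra.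
  have := ler_normB (h (y (kj n) - x)) (h (y (kj n) - x) - E + (E - d (kj n) (kj n))).
  have -> : h (y (kj n) - x) - (h (y (kj n) - x) - E + (E - d (kj n) (kj n))) = d (kj n) (kj n) by ring.
  have := ler_normD (h (y (kj n) - x) - E) (E - d (kj n) (kj n)).
  lra.
have [x' clx'] := @rwc_cluster _ _ _ _ y (fun k => exists n, k = kj n) cW
  (fun n => ex_intro2 _ _ (kj n) (leq_trans (Njge n) (proj1 (andP (kjP n)))) (ex_intro _ n erefl))
  (fun k _ => Wy k).
have gx i : g i x' = g i x.
  apply/eqP; rewrite -subr_eq0 -normr_le0; apply/ler_addgt0Pr => dl dl0; rewrite add0r.
  have dl20 : 0 < dl / 2 by lra.
  (* From hump J on, i belongs to the head, and the head bound is at most dl / 2. *)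
  pose J := maxn i.+1 (Num.truncn ((dl / 2)^-1 * (e / 8))).+1.
  have [k [kge [n kn] hk]] := clx' g i.+1 _ (Nj J) Phig dl20.
  have {}hk := hk i (ltnSn i).
  have Jn : (J <= n)%N.
    by rewrite leqNgt; apply/negP => /Njm; have := kjP n; lia.
  have [_ _ _ dk _] := hP (Nj n); rewrite -/(kj n) -kn in dk.
  have {}dk := dk i.
  have /dk {}dk : (i < Nj n)%N by have := Njge n; rewrite /J in Jn; lia.
  have : e / 8 / (Nj n).+1%:R <= dl / 2.
    rewrite ler_pdivrMr // -ler_pdivrMl //.
    apply: le_trans (ltW (truncnS_gt _)) _; rewrite ler_nat.
    rewrite ltnS; apply: leq_trans (Njge n); apply: leq_trans Jn; exact: leq_trans (leqnSn _) (leq_maxr _ _).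
  move=> /(lt_le_trans dk) {}dk; rewrite /d in dk.
  have := ler_normB (g i (y k) - g i x) (g i (y k) - g i x').
  have -> : g i (y k) - g i x - (g i (y k) - g i x') = g i x' - g i x by ring.
  lra.
have hx : h x' = h x.
  apply: sums_to_uniq (hS x') _; have := hS x; congr sums_to.
  by apply/funext => i; rewrite gx.
have e40 : 0 < e / 4 by lra.
have [k [_ [n kn] hk]] := clx' (fun=> h) 1%N _ 0%N (fun=> PhiN h lh hN) e40.
by have := hk 0%N isT; rewrite hx kn; have := far n; lra.
Qed.

End Schur.

(** * Disjoint sequences and the bilinear form of the theorem *)

Section DualSystem.
Context {R : realType} {V : lmodType R}.
Variables (j : V -> V -> V) (Phi : set (V -> R)).
Local Notation "x <<= y" := (rle j x y) (at level 70).

(** All that is used of a Banach lattice and its dual, free of norms, so that it covers both E with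
    E' and F' with F''. *)
Record dual_system : Prop := {
  ds_lin : forall f, Phi f -> linform f;
  ds_dom : forall f, Phi f ->
    exists g, [/\ Phi g, posform j g & forall x, `|f x| <= g (rabs j x)];
  ds_solid : forall f g, Phi f -> linform g ->
    (forall x, `|g x| <= f (rabs j x)) -> Phi g }.

Hypotheses (H : riesz j) (DS : dual_system).

(* The component of [f] carried by [u n] sees only one of the two parts of
   [a n], and these components are summable because the [u n] are disjoint. *)
Lemma disjoint_signed_null (A : set V) (a u : nat -> V) f :
  rel_weak_compact Phi A -> (forall n, A (a n)) -> Phi f -> posform j f ->
  (forall n, 0 <<= u n) -> rdisj j u ->
  (forall n, u n <<= rpos j (a n)) \/ (forall n, u n <<= rpos j (- a n)) ->
  tends0 (fun n => f (u n)).
Proof.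
move=> cA Aa Pf pf u0 ud ua; have lf := ds_lin DS Pf.
have [g hg] := choice (fun n => component H lf pf (u0 n)).
have lg n : linform (g n) by case: (hg n).
have pg n : posform j (g n) by case: (hg n).
(* Up to a small error the components are the values of f at the meets of x with c_i u_i. These
   meets are disjoint and below x, so their sum is below x too. *)
have gf n x : 0 <<= x -> \sum_(i < n) g i x <= f x.
  move=> x0; apply/ler_addgt0Pr => e e0.
  have en0 : 0 < e / n.+1%:R by rewrite divr_gt0.
  have hc i : exists c, 0 < c /\ g i x < f (rmeet j x (c *: u i)) + e / n.+1%:R.
    by have [_ _ _ _ /(_ x _ x0 en0)[c c0 hc]] := hg i; exists c.
  have [c hc'] := choice hc.
  apply: (@le_trans _ _ (\sum_(i < n) (f (rmeet j x (c i *: u i)) + e / n.+1%:R))).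
    by apply: ler_sum => i _; apply/ltW; exact: (hc' i).2.
  rewrite big_split /=; apply: lerD.
    rewrite -(linform_sum lf n (fun i => rmeet j x (c i *: u i))).
    have cu i : 0 <<= c i *: u i by apply: rscale_ge0 => //; apply/ltW; exact: (hc' i).1.
    apply: (posform_le H) => //; apply: (@rsum_disj _ _ _ H _ (fun i => rmeet j x (c i *: u i))) => //.
    - by move=> i; exact: rmeet_ge0.
    - move=> i k ik; have ci := ltW (hc' i).1; have ck := ltW (hc' k).1.
      apply: (@rmeet0_le _ _ _ H _ _ (c i *: u i) (c k *: u k)).
      + exact: rmeet_ge0.
      + exact: rmeet_ge0.
      + exact: rmeet_ler.
      + exact: rmeet_ler.
      + by apply: rmeet0Z => //; exact: ud.
    - by move=> i; exact: rmeet_lel.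
  have nn : n%:R <= n.+1%:R :> R by rewrite ler_nat.
  rewrite sumr_const card_ord -[X in X <= _]mulr_natr mulrAC.
  by rewrite ler_pdivrMr // ler_pM2l.
have gN n x : \sum_(i < n) `|g i x| <= f (rabs j x).
  apply: le_trans (gf n _ (rabs_ge0 H x)); apply: ler_sum => i _; exact: posform_abs.
have PhiN h : linform h -> (forall x, `|h x| <= f (rabs j x)) -> Phi h by exact: ds_solid.
move=> e e0; have [N hN] := schur cA lg gN PhiN Aa e0.
exists N => n /hN; apply: le_trans; rewrite ger0_norm; last exact: pf.
(* The component keeps the value f (u n) and vanishes on the part of a n disjoint from u n, whence f
   (u n) <= |g n (a n)|, which tends to 0 by [schur]. *)
have [_ _ gu gz _] := hg n; rewrite -gu -[a n in X in _ <= X](rposB H) linformB //.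
have z0 x : u n <<= rpos j x -> g n (rpos j (- x)) = 0.
  move=> ux; apply: gz; first exact: rpos_ge0.
  apply: (rmeet0_le H _ _ (rle_refl H _) ux); [exact: rpos_ge0|exact: u0|].
  by rewrite (rmeetC H); exact: rmeet_posN.
have gm x : u n <<= x -> g n (u n) <= g n x by exact: (posform_le H (lg n) (pg n)).
case: ua => /(_ n) ua.
  rewrite (z0 _ ua) subr0 ger0_norm; [exact: gm|by apply: pg; exact: rpos_ge0].
have := z0 _ ua; rewrite opprK => ->.
rewrite sub0r normrN ger0_norm; [exact: gm|by apply: pg; exact: rpos_ge0].
Qed.

(** Since |a n| = (a n)^+ + (a n)^-, Riesz decomposition splits v n into two disjoint sequences,
    each below a single signed part. *)
Lemma disjoint_weakly_null (A : set V) (a v : nat -> V) :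
  rel_weak_compact Phi A -> (forall n, A (a n)) ->
  (forall n, 0 <<= v n) -> (forall n, v n <<= rabs j (a n)) -> rdisj j v ->
  forall f, Phi f -> tends0 (fun n => f (v n)).
Proof.
move=> cA Aa v0 va vd f0 Pf0.
have [f [Pf pf f0f]] := ds_dom DS Pf0; have lf := ds_lin DS Pf.
have dec n : exists p : V * V, [/\ v n = p.1 + p.2, 0 <<= p.1, p.1 <<= rpos j (a n),
    0 <<= p.2 & p.2 <<= rpos j (- a n)].
  have [|x1 [x2 h]] := riesz_decomp H (v0 n) (rpos_ge0 H (a n)) (rpos_ge0 H (- a n)).
    by rewrite -(rabsE H).
  by exists (x1, x2).
have [p hp] := choice dec.
have le1 n : (p n).1 <<= v n.
  by have [-> _ _ h _] := hp n; rewrite -{1}[(p n).1]addr0; exact: rleD2l.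
have le2 n : (p n).2 <<= v n.
  by have [-> h _ _ _] := hp n; rewrite -{1}[(p n).2]add0r; exact: rleD2r.
have p10 n : 0 <<= (p n).1 by case: (hp n).
have p20 n : 0 <<= (p n).2 by case: (hp n).
have d1 : rdisj j (fun n => (p n).1).
  by move=> n m nm; apply: (rmeet0_le H (p10 n) (p10 m) (le1 n) (le1 m)); exact: vd.
have d2 : rdisj j (fun n => (p n).2).
  by move=> n m nm; apply: (rmeet0_le H (p20 n) (p20 m) (le2 n) (le2 m)); exact: vd.
have t1 : tends0 (fun n => f (p n).1).
  by apply: (disjoint_signed_null cA Aa) => //; left => n; case: (hp n).
have t2 : tends0 (fun n => f (p n).2).
  by apply: (disjoint_signed_null cA Aa) => //; right => n; case: (hp n).
move=> e e0; have e20 : 0 < e / 2 by lra.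
have [N1 h1] := t1 _ e20; have [N2 h2] := t2 _ e20.
exists (maxn N1 N2) => n; rewrite geq_max => /andP[/h1 {}h1 /h2 {}h2].
apply: le_trans (f0f _) _; rewrite (rabs_id H) //.
have [-> _ _ _ _] := hp n; rewrite linformD //.
by have := ler_norm (f (p n).1); have := ler_norm (f (p n).2); lra.
Qed.

(** L need not be positive, so the bound passes from the interval [0, h] to [0, c h] by homogeneity
    instead of monotonicity. *)
Lemma linform_scale_bound (L : V -> R) h r (c M : R) : linform L ->
  (forall r, 0 <<= r -> r <<= h -> `|L r| <= M) -> 0 < c ->
  0 <<= r -> r <<= c *: h -> `|L r| <= c * M.
Proof.
move=> lL hM c0 r0 rh; have ci : 0 <= c^-1 by rewrite invr_ge0 ltW.
have -> : r = c *: (c^-1 *: r) by rewrite scalerA divff ?scale1r // lt0r_neq0.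
rewrite linformZ // normrM gtr0_norm // ler_pM2l //; apply: hM.
  exact: rscale_ge0.
by have := rleZ H ci rh; rewrite scalerA mulVf ?scale1r // lt0r_neq0.
Qed.

End DualSystem.

Lemma geo_small {R : realType} (C e : R) : 0 <= C -> 0 < e ->
  exists N, forall n, (N <= n)%N -> (2 ^+ n)^-1 * C <= e.
Proof.
move=> C0 e0; exists (Num.truncn (e^-1 * C)).+1 => n hn.
rewrite mulrC ler_pdivrMr ?exprn_gt0 // -ler_pdivrMl //.
apply: le_trans (ltW (truncnS_gt _)) _.
rewrite -natrX ler_nat; apply: leq_trans hn _; exact: ltnW (ltn_expl _ _).
Qed.

(** * Bilinear forms dominated in each variable *)

Section Bilinear.
Context {R : realType} {X Y : lmodType R}.
Variables (jX : X -> X -> X) (jY : Y -> Y -> Y).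
Variables (PhiX : set (X -> R)) (PhiY : set (Y -> R)) (beta : X -> Y -> R).
Hypotheses (HX : riesz jX) (HY : riesz jY).
Hypotheses (DSX : dual_system jX PhiX) (DSY : dual_system jY PhiY).
Hypotheses (bl1 : forall y, linform (beta^~ y)) (bl2 : forall x, linform (beta x)).
Local Notation "x <<=X y" := (rle jX x y) (at level 70).
Local Notation "x <<=Y y" := (rle jY x y) (at level 70).

(** The substitute for a modulus of [beta]: one functional dominates uniformly over an order
    interval of the other variable. This controls remainders of which only an upper bound is
    known. *)
Hypothesis domY : forall h, 0 <<=Y h -> exists phi, PhiX phi /\
  forall r v, 0 <<=Y r -> r <<=Y h -> 0 <<=X v -> `|beta v r| <= phi v.
Hypothesis domX : forall z, 0 <<=X z -> exists psi, PhiY psi /\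
  forall r g, 0 <<=X r -> r <<=X z -> 0 <<=Y g -> `|beta r g| <= psi g.
Hypothesis bDP : forall v g,
  (forall n, 0 <<=X v n) -> rdisj jX v ->
  (forall phi, PhiX phi -> tends0 (fun n => phi (v n))) ->
  (forall n, 0 <<=Y g n) -> rdisj jY g ->
  (forall psi, PhiY psi -> tends0 (fun n => psi (g n))) ->
  tends0 (fun n => beta (v n) (g n)).

Theorem bilinear_approx (A : set X) (B : set Y) (e : R) :
  rel_weak_compact PhiX A -> rel_weak_compact PhiY B ->
  (forall a, (forall n : nat, A (a n)) -> exists y, 0 <<=X y /\
     forall n, (2 ^+ n)^-1 *: rabs jX (a n) <<=X y) ->
  (forall b, (forall n : nat, B (b n)) -> exists y, 0 <<=Y y /\
     forall n, (2 ^+ n)^-1 *: rabs jY (b n) <<=Y y) ->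
  0 < e -> exists u, 0 <<=X u /\ forall a b, A a -> B b ->
    beta (rpos jX (rabs jX a - u)) (rabs jY b) <= e.
Proof.
move=> cA cB majX majY e0; apply: contrapT => /forallNP bad.
have pick u : exists p : X * Y, 0 <<=X u -> [/\ A p.1, B p.2 &
    e < beta (rpos jX (rabs jX p.1 - u)) (rabs jY p.2)].
  (* [choice] wants a total function; the pair (0, 0) is a dummy value for u outside the cone. *)
  have [u0|nu0] := pselect (0 <<=X u); last by exists (0, 0).
  have /not_andP[//|/existsNP[a /existsNP[b /not_implyP[Aa /not_implyP[Bb /negP]]]]] := bad u.
  by rewrite -ltNge => h; exists (a, b).
have [P hP] := choice pick.
pose s := fix F n := if n is m.+1 then F m + rabs jX (P (16 ^+ m *: F m)).1 else 0.
pose a n := (P (16 ^+ n *: s n)).1; pose b n := (P (16 ^+ n *: s n)).2.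
pose x n := rabs jX (a n); pose f n := rabs jY (b n).
have x0 n : 0 <<=X x n by exact: rabs_ge0.
have f0 n : 0 <<=Y f n by exact: rabs_ge0.
have sE n : s n = \sum_(i < n) x i.
  by elim: n => [|n IH]; rewrite ?big_ord0 // big_ord_recr /= -IH.
have s0 n : 0 <<=X 16 ^+ n *: s n.
  by apply: rscale_ge0; rewrite ?exprn_ge0 // sE; exact: rsum_ge0.
have Aa n : A (a n) by have [] := hP _ (s0 n).
have Bb n : B (b n) by have [] := hP _ (s0 n).
have [y [y0 xy]] := majX a Aa.
have [hb [hb0 fhb]] := majY b Bb.
pose v := disjointify jX x y.
have v0 n : 0 <<=X v n by exact: rpos_ge0.
have vx n : v n <<=X x n by exact: disjointify_le.
have vd : rdisj jX v by exact: disjointify_disj.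
have vn := disjoint_weakly_null HX DSX cA Aa v0 vx vd.
have [psi0 [Ppsi0 hpsi0]] := domX y0.
have [psi [Ppsi ppsi psi0_le]] := ds_dom DSY Ppsi0.
(* Passing from w to v n costs at most 8^-n psi0 (f n). As f n <= 2^n hb, this is at most 4^-n psi
   hb, of which the bound by 2^-n psi hb is kept. *)
have [n0 hn0] : exists n0, forall n, (n0 <= n)%N -> e / 2 <= beta (v n) (f n).
  have e20 : 0 < e / 2 by lra.
  have [n0 hn0] := geo_small (ppsi _ hb0) e20; exists n0 => n /hn0 {}hn0.
  pose w := rpos jX (x n - 16 ^+ n *: s n).
  have ew : e < beta w (f n) by have [] := hP _ (s0 n).
  have i8 : 0 < (8 ^+ n)^-1 :> R by rewrite invr_gt0 exprn_gt0.
  have y8 : 0 <<=X (8 ^+ n)^-1 *: y by apply: rscale_ge0 => //; exact: ltW.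
  have vw : v n <<=X w.
    by apply: (rle_rpos HX); rewrite -sE; exact: rle_subr.
  have wv : w - v n <<=X (8 ^+ n)^-1 *: y.
    apply: (rleBl HX); apply: (rpos_le HX); last exact: raddr_ge0.
    have := rleD2r HX ((8 ^+ n)^-1 *: y) (rpos_ge HX (x n - 16 ^+ n *: \sum_(i < n) x i - (8 ^+ n)^-1 *: y)).
    by rewrite subrK sE.
  have wv0 : 0 <<=X w - v n by apply/(rsub_ge0 HX).
  have h1 := linform_scale_bound HX (bl1 (f n))
    (fun r r0 ry => hpsi0 r (f n) r0 ry (f0 n)) i8 wv0 wv.
  have h2 : psi0 (f n) <= 2 ^+ n * psi hb.
    apply: le_trans (ler_norm _) _; apply: le_trans (psi0_le _) _.
    rewrite (rabs_id HY) // -linformZ; last exact: ds_lin DSY _ _.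
    apply: (posform_le HY) => //; first exact: ds_lin DSY _ _.
    have p2 : 0 <= 2 ^+ n :> R by rewrite exprn_ge0.
    by have := rleZ HY p2 (fhb n); rewrite scalerA divff ?expf_neq0 // scale1r.
  have h3 : (8 ^+ n)^-1 * psi0 (f n) <= (2 ^+ n)^-1 * psi hb.
    apply: le_trans (ler_wpM2l (ltW i8) h2) _; rewrite mulrA ler_wpM2r //; first exact: ppsi.
    have -> : 8 = 2 * 2 * 2 :> R by lra.
    rewrite !exprMn; set t := 2 ^+ n.
    have t1 : 1 <= t by rewrite exprn_ege1 //; lra.
    have t0 : 0 < t by lra.
    have -> : (t * t * t)^-1 * t = t^-1 * t^-1 by field; rewrite lt0r_neq0.
    by rewrite ler_piMl ?invr_ge0 ?(ltW t0) // invf_le1.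
  have /= bB := linformB (bl1 (f n)) w (v n); rewrite bB in h1.
  by have := ler_norm (beta w (f n) - beta (v n) (f n)); lra.
have domY' h : exists phi, 0 <<=Y h -> PhiX phi /\
  forall r v, 0 <<=Y r -> r <<=Y h -> 0 <<=X v -> `|beta v r| <= phi v.
  have [/domY[phi hphi]|nh] := pselect (0 <<=Y h); first by exists phi.
  by exists (fun=> 0).
have [phi hphi] := choice domY'.
have e80 : 0 < e / 8 by lra.
(* The argument q holds the step k, a lower bound for the next index and the sum of the functionals
   chosen so far. That sum is fixed when m is sought, so weak nullity of v supplies m. *)
have pick2 (q : nat * (nat * Y)) : exists m, 0 <<=Y q.2.2 ->
    (q.2.1 <= m)%N /\ phi (16 ^+ q.1 *: q.2.2) (v m) <= e / 8.
  have [q0|nq] := pselect (0 <<=Y q.2.2); last by exists 0%N.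
  have /hphi[Pp _] : 0 <<=Y 16 ^+ q.1 *: q.2.2 by apply: rscale_ge0; rewrite ?exprn_ge0.
  have [N hN] := vn _ Pp _ e80; exists (maxn q.2.1 N) => _; rewrite leq_maxl; split=> //.
  by apply: le_trans (ler_norm _) _; apply: hN; exact: leq_maxr.
have [Q hQ] := choice pick2.
(* The state pairs the least admissible next index with the accumulated sum; starting at n0 keeps
   the lower bound e / 2 valid along the subsequence. *)
pose st := fix F k := if k is k'.+1 then
  ((Q (k', F k')).+1, (F k').2 + f (Q (k', F k'))) else (n0, 0).
pose sg k := Q (k, st k).
have stE k : (st k).2 = \sum_(i < k) f (sg i).
  by elim: k => [|k IH]; rewrite ?big_ord0 // big_ord_recr /= -IH.
have st0 k : 0 <<=Y (st k).2 by rewrite stE; apply: (@rsum_ge0 _ _ _ HY _ (fun i => f (sg i))).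
have sgP k : ((st k).1 <= sg k)%N /\ phi (16 ^+ k *: (st k).2) (v (sg k)) <= e / 8.
  exact: (hQ (k, st k) (st0 k)).
have sgS k : (sg k < sg k.+1)%N by have [] := sgP k.+1.
have sg_ge k : (n0 + k <= sg k)%N.
  elim: k => [|k IH]; first by have [] := sgP 0%N; rewrite addn0.
  by rewrite addnS; exact: leq_ltn_trans IH (sgS k).
have sgm i k : (i < k)%N -> (sg i < sg k)%N.
  elim: k => // k IH; rewrite ltnS leq_eqVlt => /predU1P[->//|/IH h].
  exact: ltn_trans h (sgS k).
(* [hb] only controls 2^-(sg n) f (sg n); disjointifying the subsequence needs the weight 2^-n,
   hence a new majorant. *)
have [hs [hs0 fhs]] := majY (b \o sg) (fun n => Bb (sg n)).
pose g := disjointify jY (f \o sg) hs.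
have fs0 n : 0 <<=Y (f \o sg) n by exact: f0.
have g0 n : 0 <<=Y g n by exact: rpos_ge0.
have gf n : g n <<=Y f (sg n) by exact: (disjointify_le HY).
have gd : rdisj jY g by exact: disjointify_disj.
have gn := disjoint_weakly_null HY DSY cB (fun n => Bb (sg n)) g0 gf gd.
have vsd : rdisj jX (v \o sg).
  move=> n m /eqP; rewrite neq_lt => /orP[] /sgm h; apply: vd => eq; rewrite eq ltnn in h; exact: notF.
have vsn p : PhiX p -> tends0 (fun n => p ((v \o sg) n)).
  move=> /vn h d d0; have [N hN] := h d d0; exists N => n Nn; apply: hN.
  by have := sg_ge n; lia.
have [N1 hN1] := bDP (fun n => v0 (sg n)) vsd vsn g0 gd gn e80.
have [Phs hhs] := hphi _ hs0.
have [N2 hN2] := vsn _ Phs _ e80.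
pose k := maxn N1 N2.
have := hN1 k (leq_maxl _ _); have /= := hN2 k (leq_maxr _ _).
have := hn0 (sg k) (leq_trans (leq_addr _ _) (sg_ge k)).
have [_ hk] := sgP k.
have i8 : 0 < (8 ^+ k)^-1 :> R by rewrite invr_gt0 exprn_gt0.
have r0 : 0 <<=Y f (sg k) - g k by apply/(rsub_ge0 HY).
have h16 : 0 <<=Y 16 ^+ k *: (st k).2 by apply: rscale_ge0; rewrite ?exprn_ge0.
have h8 : 0 <<=Y (8 ^+ k)^-1 *: hs by apply: rscale_ge0 => //; exact: ltW.
have rle' : f (sg k) - g k <<=Y 16 ^+ k *: (st k).2 + (8 ^+ k)^-1 *: hs.
  apply: (rleBl HY).
  have := rleD2r HY (16 ^+ k *: (st k).2 + (8 ^+ k)^-1 *: hs)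
    (rpos_ge HY (f (sg k) - 16 ^+ k *: \sum_(i < k) f (sg i) - (8 ^+ k)^-1 *: hs)).
  have cancel p q r : p - q - r + (q + r) = p :> Y by rewrite -(addrA p) -opprD subrK.
  by rewrite stE cancel.
(* The remainder splits according to its two causes: r1 is small by the choice of [sg k], r2 because
   [phi hs] tends to 0 along v. *)
have [r1 [r2 [er r10 r1h r20 r2h]]] := riesz_decomp HY r0 h16 h8 rle'.
have b1 : `|beta (v (sg k)) r1| <= e / 8.
  by apply: le_trans hk; have [_ h] := hphi _ h16; exact: h.
have b2 := linform_scale_bound HY (bl2 (v (sg k)))
    (fun r r0 rh => hhs r (v (sg k)) r0 rh (v0 _)) i8 r20 r2h.
have b3 : (8 ^+ k)^-1 * phi hs (v (sg k)) <= `|phi hs (v (sg k))|.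
  apply: le_trans (ler_wpM2l (ltW i8) (ler_norm _)) _.
  by rewrite ler_piMl // invf_le1 ?exprn_gt0 // exprn_ege1 //; lra.
(* Contradiction: the value at f (sg k) is at least e / 2, but its three summands, at g k, r1 and
   r2, are at most e / 8 each. *)
have -> : beta (v (sg k)) (g k) = beta (v (sg k)) (f (sg k)) - (beta (v (sg k)) r1 + beta (v (sg k)) r2).
  by rewrite -linformD // -er linformB //; ring.
have := ler_norm (beta (v (sg k)) r1); have := ler_norm (beta (v (sg k)) r2).
move=> c1 c2 c3 c4.
have := ler_norm (beta (v (sg k)) (f (sg k)) - (beta (v (sg k)) r1 + beta (v (sg k)) r2)).
lra.
Qed.

End Bilinear.

(** * Hahn-Banach and boundedness of weakly compact sets *)

Section HahnBanach.
Context {R : realType} {V : normedModType R}.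

(* Zorn's lemma is applied to graphs of norm-dominated partial linear forms; the
   empty graph is admitted so that the empty chain has an upper bound. *)
Lemma hahn_banach_norming (x : V) : exists h : V -> R,
  [/\ linform h, forall z, `|h z| <= `|z| & h x = `|x| ].
Proof.
pose P (G : set (V * R)) := [/\
  forall (a : R) p q, G p -> G q -> G (a *: p.1 + q.1, a * p.2 + q.2),
  forall p, G p -> p.2 <= `|p.1| & G !=set0 -> G (x, `|x|)].
have [A [[Alin Ale Ane] Amax]] : exists A, P A /\ forall B, A `<` B -> ~ P B.
  apply: Zorn_bigcup => F FP Ftot; split.
  - move=> a p q [X1 F1 p1] [X2 F2 q2].
    have [s|s] := Ftot _ _ F1 F2.
      by exists X2 => //; have [h _ _] := FP _ F2; apply: h => //; exact: s.
    by exists X1 => //; have [h _ _] := FP _ F1; apply: h => //; exact: s.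
  - by move=> p [X F1 p1]; have [_ h _] := FP _ F1; exact: h.
  - by move=> [p [X F1 p1]]; exists X => //; have [_ _ h] := FP _ F1; apply: h; exists p.
(* The maximal graph is not the empty one, which the line through x properly extends. *)
have Ax : A (x, `|x|).
  apply: contrapT => nAx.
  have A0 p : ~ A p by move=> Ap; apply: nAx; apply: Ane; exists p.
  pose B := [set p : V * R | exists t : R, p = (t *: x, t * `|x|)].
  apply: (Amax B).
    split; first by move=> p /A0.
    by move=> /(_ (x, `|x|)) h; apply: (A0 (x, `|x|)); apply: h; exists 1; rewrite scale1r mul1r.
  split.
  - move=> a _ _ [t ->] [s ->] /=; exists (a * t + s).
    by rewrite scalerDl scalerA mulrDl mulrA.
  - by move=> _ [t ->] /=; rewrite normrZ ler_wpM2r // ler_norm.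
  - by move=> _; exists 1; rewrite scale1r mul1r.
have A00 : A (0, 0) by have := Alin (-1) _ _ Ax Ax; rewrite /= scaleN1r mulN1r !addNr.
have AZ a p : A p -> A (a *: p.1, a * p.2).
  by move=> /(Alin a) /(_ A00); rewrite /= !addr0.
have Afun z r r' : A (z, r) -> A (z, r') -> r = r'.
  move=> h1 h2; apply/eqP; rewrite eq_le.
  have := Ale _ (Alin (-1) _ _ h1 h2); have := Ale _ (Alin (-1) _ _ h2 h1).
  by rewrite /= !scaleN1r !addNr normr0; lra.
have Adom z : exists r, A (z, r).
  apply: contrapT => /forallNP nz.
  (* One-dimensional extension: a value c at z preserves the domination when it lies between all p.2
     - |p.1 - z| and all |q.1 + z| - q.2; [cross] shows that such a c exists. *)
  pose S := [set p.2 - `|p.1 - z| | p in A].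
  have cross p q : A p -> A q -> p.2 - `|p.1 - z| <= `|q.1 + z| - q.2.
    move=> Ap Aq; have := Ale _ (Alin 1 _ _ Ap Aq); rewrite /= scale1r mul1r.
    have := ler_normD (p.1 - z) (q.1 + z).
    have -> : p.1 - z + (q.1 + z) = p.1 + q.1 by rewrite [q.1 + z]addrC addrA subrK.
    lra.
  have hS : has_sup S.
    split; first by exists (0 - `|0 - z|), (0, 0).
    by exists (`|0 + z| - 0) => _ [p Ap <-]; exact: cross Ap A00.
  pose c := sup S.
  have cge p : A p -> p.2 - `|p.1 - z| <= c.
    by move=> Ap; apply: ub_le_sup; [exact: hS.2|exists p].
  have cle p : A p -> c <= `|p.1 + z| - p.2.
    by move=> Ap; apply: ge_sup; [exact: hS.1|move=> _ [q Aq <-]; exact: cross].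
  pose B := [set p : V * R | exists q t, A q /\ p = (q.1 + t *: z, q.2 + t * c)].
  apply: (Amax B).
    split.
      by move=> p Ap; exists p, 0; split=> //; rewrite scale0r mul0r !addr0; case: (p).
    move=> /(_ (z, c)) h; apply: (nz c); apply: h.
    by exists (0, 0), 1; split=> //; rewrite scale1r mul1r !add0r.
  split.
  - move=> a _ _ [p [t [Ap ->]]] [q [s [Aq ->]]] /=.
    exists (a *: p.1 + q.1, a * p.2 + q.2), (a * t + s); split; first exact: Alin.
    congr pair => /=; last by ring.
    by rewrite scalerDr scalerDl scalerA addrACA.
  - move=> _ [p [t [Ap ->]]] /=; have [t0|t0|<-] := ltgtP 0 t.
    + have nt (w : V) : t * `|w| = `|t *: w| by rewrite normrZ gtr0_norm.
      have := cle _ (AZ t^-1 _ Ap) => /=; rewrite -(ler_pM2l t0) mulrBr mulrA divff ?gt_eqF // mul1r.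
      rewrite nt scalerDr scalerA divff ?gt_eqF // scale1r; lra.
    + have s0 : 0 < - t by lra.
      have nt (w : V) : - t * `|w| = `|- t *: w| by rewrite normrZ gtr0_norm.
      have sn : - t != 0 by rewrite gt_eqF.
      have := cge _ (AZ (- t)^-1 _ Ap) => /=; rewrite -(ler_pM2l s0) mulrBr mulrA divff // mul1r.
      rewrite nt scalerBr scalerA divff // scale1r scaleNr opprK; lra.
    + by rewrite scale0r mul0r !addr0; exact: Ale.
  - by move=> _; exists (x, `|x|), 0; split=> //=; rewrite scale0r mul0r !addr0.
have [h hh] := choice Adom.
have hle z : h z <= `|z| by exact: (Ale _ (hh z)).
have lh : linform h.
  by move=> a y z; apply: (Afun _ _ _ (hh _)); exact: (Alin a _ _ (hh y) (hh z)).
exists h; split=> //; last exact: (Afun _ _ _ (hh _)).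
move=> z; rewrite ler_norml hle andbT.
by have := hle (- z); rewrite normrN linformN //; lra.
Qed.

End HahnBanach.

Section DualSet.
Context {R : realType} {V : normedModType R}.

Lemma dual_setP (f : V -> R) :
  dual_set f <-> linform f /\ exists C : R, forall x, `|f x| <= C * `|x|.
Proof.
split=> [[lf cf]|[lf [C fC]]].
  split=> //; pose lin : linear f := lf.
  pose F : {linear V -> R} := HB.pack f (GRing.isLinear.Build _ _ _ _ _ lin).
  have : continuous F by [].
  move=> /linear_bounded_continuous/linear_boundedP[M [_ hM]].
  by exists (M + 1); apply: hM; rewrite ltrDl.
split=> //; pose lin : linear f := lf.
pose F : {linear V -> R} := HB.pack f (GRing.isLinear.Build _ _ _ _ _ lin).
suff : continuous F by [].
apply/linear_bounded_continuous/linear_boundedP; exists C; split; first exact: num_real.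
move=> r Cr x; apply: le_trans (fC x) _; apply: ler_wpM2r => //; exact: ltW.
Qed.

Lemma geo_sum n : \sum_(i < n) (2 ^+ i)^-1 <= 2 :> R.
Proof.
suff : \sum_(i < n) (2 ^+ i)^-1 = 2 - 2 * (2 ^+ n)^-1 :> R.
  by move=> ->; have : 0 < (2 ^+ n)^-1 :> R by [rewrite invr_gt0 exprn_gt0]; lra.
elim: n => [|n IH]; first by rewrite big_ord0 expr0 invr1; lra.
rewrite big_ord_recr /= IH exprS invfM; lra.
Qed.

(* [2^-n phi_n] with [phi_n] norming for [a_n] is summable, so Schur's lemma
   forbids [|a_n| > 2^n]. *)
Lemma rwc_bounded (A : set V) : rwc_E A -> exists C : R, forall a, A a -> `|a| <= C.
Proof.
move=> cA; apply: contrapT => /forallNP bad.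
have pick n : exists a, A a /\ 2 ^+ n < `|a|.
  have /existsNP[a /not_implyP[Aa /negP]] := bad (2 ^+ n).
  by rewrite -ltNge => h; exists a.
have [a ha] := choice pick.
have [h hh] := choice (fun n => hahn_banach_norming (a n)).
pose g n x := (2 ^+ n)^-1 * h n x.
have i2 n : 0 <= (2 ^+ n)^-1 :> R by rewrite invr_ge0 exprn_ge0.
have lg n : linform (g n).
  by move=> c x y; rewrite /g; have [-> _ _] := hh n; ring.
have gN n x : \sum_(i < n) `|g i x| <= 2 * `|x|.
  apply: (@le_trans _ _ (\sum_(i < n) (2 ^+ i)^-1 * `|x|)).
    apply: ler_sum => i _; rewrite /g normrM ger0_norm // ler_wpM2l //.
    by have [_ -> _] := hh i.
  by rewrite -mulr_suml ler_wpM2r // geo_sum.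
have PhiN (f : V -> R) : linform f -> (forall x, `|f x| <= 2 * `|x|) -> dual_set f.
  by move=> lf hf; apply/dual_setP; split => //; exists 2.
have h0 : 0 < 2^-1 :> R by lra.
have [N /(_ N (leqnn N))] := schur cA lg gN PhiN (fun n => (ha n).1) h0.
rewrite /g normrM ger0_norm //; have [_ _ ->] := hh N; rewrite normr_id.
rewrite ler_pdivrMl ?exprn_gt0 //; have := (ha N).2.
by have : 0 < 2 ^+ N :> R by [rewrite exprn_gt0]; lra.
Qed.

End DualSet.

(** * Banach lattices and their dual spaces *)

Section BanachLattice.
Context {R : realType} {E : normedModType R}.
Variable j : E -> E -> E.
Hypothesis HE : banach_lattice j.
Local Notation "x <<= y" := (rle j x y) (at level 70).

Lemma bl_riesz : riesz j.
Proof. by case: HE => h1 h2 h3 h4 h5 _; split. Qed.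
Let H := bl_riesz.

Lemma bl_norm_le x v : rabs j x <<= v -> `|x| <= `|v|.
Proof.
move=> xv; apply: (bl_norm HE); have v0 := rle_trans H (rabs_ge0 H x) xv.
by have := rabs_id H v0; rewrite /vle /vabs /rabs => ->.
Qed.

Lemma bl_norm_abs x : `|rabs j x| = `|x|.
Proof.
have e := rabs_id H (rabs_ge0 H x).
apply/eqP; rewrite eq_le; apply/andP; split; last by apply: bl_norm_le; exact: rle_refl.
by apply: (bl_norm HE); rewrite [vabs _ _]e; exact: (rle_refl H).
Qed.

Lemma dual_system_dual_set : dual_system j (@dual_set R E).
Proof.
split.
- by move=> f /dual_setP[].
- move=> f /dual_setP[lf [C fC]].
  have [|g [lg pg fg gC _]] := @modulus _ _ _ H f (fun v => `|C| * `|v|) lf.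
    move=> x v xv; apply: le_trans (fC x) _.
    apply: (@le_trans _ _ (`|C| * `|x|)); first by rewrite ler_wpM2r // ler_norm.
    by rewrite ler_wpM2l // bl_norm_le.
  exists g; split=> //; apply/dual_setP; split=> //; exists `|C| => x.
  apply: le_trans (posform_abs H x lg pg) _; rewrite -[in leRHS](bl_norm_abs x).
  by apply: gC; exact: rabs_ge0.
- move=> f g /dual_setP[lf [C fC]] lg gf; apply/dual_setP; split=> //; exists C => x.
  apply: le_trans (gf x) _; apply: le_trans (ler_norm _) _.
  by rewrite -[in leRHS](bl_norm_abs x).
Qed.

(** The cone is closed: (z - y)^+ <= |s m - y| for m >= N, so its norm is arbitrarily small. *)
Lemma rle_lim (s : nat -> E) (y z : E) N : s @ \oo --> y ->
  (forall m, (N <= m)%N -> z <<= s m) -> z <<= y.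
Proof.
move=> sy zs; suff p0 : rpos j (z - y) = 0.
  by have := rpos_ge H (z - y); rewrite p0 => /(rleD2r H y); rewrite subrK add0r.
apply/eqP; rewrite -normr_le0; apply/ler_addgt0Pr => e e0; rewrite add0r.
have /(@cvgr_dist_le _ E) /(_ e e0) [M _ hM] := sy.
have := hM (maxn M N) (leq_maxl _ _) => /=; apply: le_trans; rewrite distrC.
apply: (@le_trans _ _ `|rabs j (s (maxn M N) - y)|); last by rewrite bl_norm_abs.
apply: bl_norm_le; rewrite (rabs_id H (rpos_ge0 H _)).
apply: (rpos_le H); last exact: rabs_ge0.
apply: (rle_trans H _ (rabs_ge H _)); apply: (rleD2r H); apply: zs.
exact: leq_maxr.
Qed.

End BanachLattice.

Section CompleteLattice.
Context {R : realType} {E : completeNormedModType R}.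
Variable j : E -> E -> E.
Hypothesis HE : banach_lattice j.
Let H := bl_riesz HE.
Local Notation "x <<= y" := (rle j x y) (at level 70).

(** The witness is the sum of the 2^-n x_n, which converges absolutely by completeness and lies
    above each term since the cone is closed. *)
Lemma geometric_majorant (x : nat -> E) (C : R) :
  (forall n, 0 <<= x n) -> (forall n, `|x n| <= C) ->
  exists y, 0 <<= y /\ forall n, (2 ^+ n)^-1 *: x n <<= y.
Proof.
move=> x0 xC; pose u n := (2 ^+ n)^-1 *: x n.
have i2 n : 0 <= (2 ^+ n)^-1 :> R by rewrite invr_ge0 exprn_ge0.
have u0 n : 0 <<= u n by exact: rscale_ge0.
have C0 : 0 <= C by apply: le_trans (xC 0%N).
have cn : cvgn [normed series u].
  apply: nondecreasing_is_cvgn.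
    move=> n m nm; rewrite /= !seriesEord.
    have := @sum_norm_mono R (fun i => `|u i|) n m nm.
    by under eq_bigr do rewrite normr_id; under [leRHS]eq_bigr do rewrite normr_id.
  exists (2 * C) => _ [n _ <-] /=; rewrite seriesEord.
  apply: (@le_trans _ _ (\sum_(i < n) (2 ^+ i)^-1 * C)).
    by apply: ler_sum => i _; rewrite /u normrZ ger0_norm // ler_wpM2l.
  by rewrite -mulr_suml ler_wpM2r // geo_sum.
have c := normed_cvg cn; exists (limn (series u)).
have le n : u n <<= limn (series u).
  apply: (@rle_lim _ _ _ HE (series u) _ _ n.+1) => // m nm; rewrite seriesEord.
  exact: rle_sum.
by split=> //; apply: (rle_trans H (u0 0%N)).
Qed.

(** Automatic continuity. If f were unbounded, there would be positive unit vectors z_n with f z_n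
    >= 4^n; a majorant y of all 2^-n z_n would give 4^n <= 2^n f y for every n. *)
Lemma posform_dual_set (f : E -> R) : linform f -> posform j f -> dual_set f.
Proof.
move=> lf pf; apply/dual_setP; split=> //; apply: contrapT => /forallNP bad.
have pick n : exists x, 4 ^+ n * `|x| < `|f x|.
  by have /existsNP[x /negP] := bad (4 ^+ n); rewrite -ltNge => h; exists x.
have [x hx] := choice pick.
have x0 n : 0 < `|x n|.
  rewrite lt_neqAle normr_ge0 andbT eq_sym; apply/negP; rewrite normr_eq0 => /eqP e.
  by have := hx n; rewrite e (linform0 lf) !normr0 mulr0 ltxx.
pose z n := `|x n|^-1 *: rabs j (x n).
have xi n : 0 <= `|x n|^-1 by rewrite invr_ge0.
have fz n : 4 ^+ n <= f (z n).
  rewrite linformZ // ler_pdivlMl // mulrC; apply: le_trans (ltW (hx n)) _.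
  exact: posform_abs.
have [||y [y0 zy]] := @geometric_majorant z 1.
- by move=> n; apply: rscale_ge0 => //; exact: rabs_ge0.
- by move=> n; rewrite /z normrZ ger0_norm // (bl_norm_abs HE) mulVf ?gt_eqF.
have h2 : 0 < 2^-1 :> R by lra.
have [N /(_ N (leqnn N))] := geo_small (pf _ y0) h2.
have p2 : 0 < 2 ^+ N :> R by rewrite exprn_gt0.
have := posform_le H lf pf (zy N); rewrite linformZ // !ler_pdivrMl //.
have := fz N; have -> : 4 = 2 * 2 :> R by lra.
rewrite exprMn; nra.
Qed.

End CompleteLattice.

(** * Vector space structure and norm of the dual *)

Section DualSpace.
Context {R : realType} {F : normedModType R}.
Implicit Types f g : dualT F.

Lemma dual_ext f g : (forall x, sval f x = sval g x) -> f = g.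
Proof.
case: f g => [f hf] [g hg] /= e; have {}e : f = g by apply/funext.
by rewrite e in hf *; congr exist; exact: Prop_irrelevance.
Qed.

Lemma dual_lin f : linform (sval f). Proof. by case: f => f []. Qed.

Fact dual_comb_subproof (a : R) f g : dual_set (fun x => a * sval f x + sval g x).
Proof.
have /dual_setP[lf [C fC]] := svalP f; have /dual_setP[lg [D gD]] := svalP g.
apply/dual_setP; split=> [b x y|]; first by rewrite lf lg; ring.
exists (`|a| * C + D) => x; apply: le_trans (ler_normD _ _) _; rewrite mulrDl.
by apply: lerD => //; rewrite normrM -mulrA ler_wpM2l.
Qed.

Fact dual_zero_subproof : @dual_set R F (fun=> 0).
Proof. by apply/dual_setP; split=> [a x y|]; [ring|exists 0 => x; rewrite normr0 mul0r]. Qed.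

(** Sum, opposite and scalar multiple are all instances of a f + g, so one proof of continuity
    covers them. *)
Definition dual_comb a f g : dualT F := exist _ _ (dual_comb_subproof a f g).
Definition dual_zero : dualT F := exist _ _ dual_zero_subproof.
Definition dual_add f g := dual_comb 1 f g.
Definition dual_opp f := dual_comb (-1) f dual_zero.
Definition dual_scale a f := dual_comb a f dual_zero.

HB.instance Definition _ := gen_eqMixin (dualT F).
HB.instance Definition _ := gen_choiceMixin (dualT F).

Fact dual_addA : associative dual_add.
Proof. by move=> f g h; apply: dual_ext => x /=; ring. Qed.
Fact dual_addC : commutative dual_add.
Proof. by move=> f g; apply: dual_ext => x /=; ring. Qed.
Fact dual_add0 : left_id dual_zero dual_add.
Proof. by move=> f; apply: dual_ext => x /=; ring. Qed.
Fact dual_addN : left_inverse dual_zero dual_opp dual_add.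
Proof. by move=> f; apply: dual_ext => x /=; ring. Qed.
HB.instance Definition _ := GRing.isZmodule.Build (dualT F)
  dual_addA dual_addC dual_add0 dual_addN.

Fact dual_scaleA (a b : R) f : dual_scale a (dual_scale b f) = dual_scale (a * b) f.
Proof. by apply: dual_ext => x /=; ring. Qed.
Fact dual_scale1 : left_id 1 dual_scale.
Proof. by move=> f; apply: dual_ext => x /=; ring. Qed.
Fact dual_scaleDr : right_distributive dual_scale +%R.
Proof. by move=> a f g; apply: dual_ext => x /=; ring. Qed.
Fact dual_scaleDl f : {morph dual_scale^~ f : a b / a + b}.
Proof. by move=> a b; apply: dual_ext => x /=; ring. Qed.
HB.instance Definition _ := GRing.Zmodule_isLmodule.Build R (dualT F)
  dual_scaleA dual_scale1 dual_scaleDr dual_scaleDl.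

Lemma dualD f g x : sval (f + g) x = sval f x + sval g x.
Proof. by rewrite /= mul1r. Qed.
Lemma dualN f x : sval (- f) x = - sval f x.
Proof. by rewrite /= mulN1r addr0. Qed.
Lemma dualZ a f x : sval (a *: f) x = a * sval f x.
Proof. by rewrite /= addr0. Qed.

Lemma dual_norm_has_sup f : has_sup [set `|sval f x| | x in [set x : F | `|x| <= 1]].
Proof.
have /dual_setP[_ [C fC]] := svalP f; split; first by exists `|sval f 0|, 0; rewrite //= normr0.
exists `|C| => _ [x x1 <-]; apply: le_trans (fC x) _.
apply: (@le_trans _ _ (`|C| * `|x|)); first by rewrite ler_wpM2r // ler_norm.
by rewrite ler_piMr.
Qed.

Lemma dual_norm_bound f x : `|sval f x| <= dnorm f * `|x|.
Proof.
have [->|x0] := eqVneq x 0; first by rewrite (linform0 (dual_lin f)) !normr0 mulr0.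
have n0 : 0 < `|x| by rewrite normr_gt0.
have ni : 0 < `|x|^-1 by rewrite invr_gt0.
rewrite mulrC -ler_pdivrMl // -{1}(gtr0_norm ni) -normrM -(linformZ (dual_lin f)).
apply: ub_le_sup; first exact: (dual_norm_has_sup f).2.
by exists (`|x|^-1 *: x) => //=; rewrite normrZ gtr0_norm // mulVf ?gt_eqF.
Qed.

Lemma dual_norm_le f (C : R) : 0 <= C -> (forall x, `|sval f x| <= C * `|x|) -> dnorm f <= C.
Proof.
move=> C0 fC; apply: ge_sup; first exact: (dual_norm_has_sup f).1.
by move=> _ [x x1 <-]; apply: le_trans (fC x) _; rewrite ler_piMr.
Qed.

Lemma dual_norm_ge0 f : 0 <= dnorm f.
Proof.
apply: (@le_trans _ _ `|sval f 0|) => //.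
by apply: ub_le_sup; [exact: (dual_norm_has_sup f).2|exists 0; rewrite //= normr0].
Qed.

End DualSpace.

(** * The dual lattice *)

Section RieszOfLub.
Context {R : realType} {V : lmodType R}.
Variables (le : V -> V -> Prop) (j : V -> V -> V).
Hypothesis le_anti : forall x y, le x y -> le y x -> x = y.
Hypothesis le_refl : forall x, le x x.
Hypothesis le_trans : forall y x z, le x y -> le y z -> le x z.
Hypothesis leD : forall z x y, le x y -> le (z + x) (z + y).
Hypothesis leZ : forall (a : R) x y, 0 < a -> le x y -> le (a *: x) (a *: y).
Hypothesis jl : forall x y, le x (j x y).
Hypothesis jr : forall x y, le y (j x y).
Hypothesis jlub : forall x y z, le x z -> le y z -> le (j x y) z.

Lemma rle_lub x y : rle j x y <-> le x y.
Proof.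
split=> [e|xy]; first by rewrite -e; exact: jl.
by apply: le_anti; [exact: jlub|exact: jr].
Qed.

(** Recovers the equations of [riesz] for a join known only as a least upper bound in an order
    invariant under translations and positive scalings. *)
Lemma riesz_of_lub : riesz j.
Proof.
split.
- by move=> x y; apply: le_anti; apply: jlub.
- move=> x y z; apply: le_anti; repeat apply: jlub => //.
  + exact: le_trans (jl x y) (jl _ _).
  + exact: le_trans (jr x y) (jl _ _).
  + exact: le_trans (jl y z) (jr _ _).
  + exact: le_trans (jr y z) (jr _ _).
- by move=> x; apply: le_anti => //; exact: jlub.
- move=> x y z; apply: le_anti; last by apply: jlub; exact: leD.
  rewrite -[X in le _ X](subrK x) [X in le _ X]addrC; apply: leD; apply: jlub.
  + by have := leD (- x) (jl (x + y) (x + z)); rewrite addKr [X in le _ X]addrC.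
  + by have := leD (- x) (jr (x + y) (x + z)); rewrite addKr [X in le _ X]addrC.
- move=> a y z a0; apply: le_anti; last by apply: jlub; exact: leZ.
  have an : a != 0 by rewrite gt_eqF.
  have ai : 0 < a^-1 by rewrite invr_gt0.
  rewrite -[X in le _ X]scale1r -(divff an) -scalerA; apply: leZ => //; apply: jlub.
  + by have := leZ ai (jl (a *: y) (a *: z)); rewrite scalerA mulVf // scale1r.
  + by have := leZ ai (jr (a *: y) (a *: z)); rewrite scalerA mulVf // scale1r.
Qed.

End RieszOfLub.

Section DualLattice.
Context {R : realType} {F : normedModType R}.
Variable j : F -> F -> F.
Hypothesis HF : banach_lattice j.
Let H := bl_riesz HF.
Implicit Types f g k : dualT F.
Local Notation "x <<= y" := (rle j x y) (at level 70).

Lemma dual_modulus_ex f : exists g, [/\ forall x, 0 <<= x -> `|sval f x| <= sval g x,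
  forall x, `|sval g x| <= dnorm f * `|x| &
  forall k, dle j (sval f) (sval k) -> dle j (sval (- f)) (sval k) ->
    dle j (sval g) (sval k)].
Proof.
have [|g [lg pg fg gC gmin]] := @modulus _ _ _ H _ (fun v => dnorm f * `|v|) (dual_lin f).
  move=> x v xv; apply: le_trans (dual_norm_bound f x) _.
  by apply: ler_wpM2l; [exact: dual_norm_ge0|exact: (bl_norm_le HF)].
have gb x : `|g x| <= dnorm f * `|x|.
  apply: le_trans (posform_abs H x lg pg) _; rewrite -[in leRHS](bl_norm_abs HF x).
  by apply: gC; exact: rabs_ge0.
have dg : dual_set g by apply/dual_setP; split=> //; exists (dnorm f).
exists (exist _ g dg); split=> [x x0|//|k fk nfk].
  by have := fg x; rewrite (rabs_id H).
apply: gmin => //; first exact: dual_lin.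
by move=> x x0; have := nfk x x0; rewrite dualN.
Qed.

Definition dual_modulus f : dualT F := projT1 (cid (dual_modulus_ex f)).

(** The identity f \/ g = (f + g + |f - g|) / 2, since [modulus] provides absolute values and not
    joins. *)
Definition dual_join f g : dualT F := 2^-1 *: (f + g + dual_modulus (f - g)).

Lemma dual_joinE f g x :
  sval (dual_join f g) x = 2^-1 * (sval f x + sval g x + sval (dual_modulus (f - g)) x).
Proof. by rewrite dualZ !dualD. Qed.

Lemma dual_modulusP f : [/\ forall x, 0 <<= x -> `|sval f x| <= sval (dual_modulus f) x,
  forall x, `|sval (dual_modulus f) x| <= dnorm f * `|x| &
  forall k, dle j (sval f) (sval k) -> dle j (sval (- f)) (sval k) ->
    dle j (sval (dual_modulus f)) (sval k)].
Proof. by rewrite /dual_modulus; case: cid. Qed.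

Lemma dual_join_ub f g : dle j (sval f) (sval (dual_join f g)) /\
  dle j (sval g) (sval (dual_join f g)).
Proof.
have [h _ _] := dual_modulusP (f - g).
split=> x x0; rewrite dual_joinE; have := h x x0; rewrite dualD dualN ler_norml => /andP[]; lra.
Qed.

Lemma dual_join_lub f g k : dle j (sval f) (sval k) -> dle j (sval g) (sval k) ->
  dle j (sval (dual_join f g)) (sval k).
Proof.
(* The functional 2k - f - g is above both f - g and its opposite, hence above |f - g|. *)
move=> fk gk x x0; have [_ _ /(_ (k + k - f - g)) h] := dual_modulusP (f - g).
have {}h : dle j (sval (dual_modulus (f - g))) (sval (k + k - f - g)).
  apply: h => y y0; have := fk y y0; have := gk y y0;
  by rewrite ?(dualN (f - g)) !dualD !dualN; lra.
by rewrite dual_joinE; have := h x x0; rewrite !dualD !dualN; lra.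
Qed.

Let dualle f g := dle j (sval f) (sval g).

Let dualle_anti f g : dualle f g -> dualle g f -> f = g.
Proof.
move=> fg gf; apply: dual_ext => x.
have e y : 0 <<= y -> sval f y = sval g y.
  by move=> y0; apply/eqP; rewrite eq_le fg ?gf.
rewrite -(rposB H x) !linformB; try exact: dual_lin.
by rewrite !e //; exact: rpos_ge0.
Qed.
Let dualle_refl f : dualle f f. Proof. by move=> x _. Qed.
Let dualle_trans g f k : dualle f g -> dualle g k -> dualle f k.
Proof. by move=> fg gk x x0; exact: le_trans (fg x x0) (gk x x0). Qed.
Let dualleD k f g : dualle f g -> dualle (k + f) (k + g).
Proof. by move=> fg x x0; rewrite !dualD lerD2l; exact: fg. Qed.
Let dualleZ (a : R) f g : 0 < a -> dualle f g -> dualle (a *: f) (a *: g).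
Proof. by move=> a0 fg x x0; rewrite !dualZ ler_pM2l //; exact: fg. Qed.

Lemma dual_riesz : riesz dual_join.
Proof.
apply: (riesz_of_lub dualle_anti dualle_refl dualle_trans dualleD dualleZ).
- by move=> f g; have [] := dual_join_ub f g.
- by move=> f g; have [] := dual_join_ub f g.
- exact: dual_join_lub.
Qed.

Lemma dual_rleP f g : rle dual_join f g <-> dle j (sval f) (sval g).
Proof.
apply: (rle_lub dualle_anti dualle_refl).
- by move=> x y; have [] := dual_join_ub x y.
- by move=> x y; have [] := dual_join_ub x y.
- exact: dual_join_lub.
Qed.

Let HD := dual_riesz.

Lemma is_dsup_join f g : is_dsup j (sval f) (sval g) (sval (dual_join f g)).
Proof.
have [h1 h2] := dual_join_ub f g; split; first exact: svalP.
by split=> //; split=> // k dk; exact: (@dual_join_lub f g (exist _ k dk)).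
Qed.

Lemma is_dinf_meet f g : is_dinf j (sval f) (sval g) (sval (rmeet dual_join f g)).
Proof.
split; first exact: svalP.
split; first by apply/dual_rleP; exact: rmeet_lel.
split; first by apply/dual_rleP; exact: rmeet_ler.
move=> k dk kf kg; apply/(dual_rleP (exist _ k dk)).
by apply: (rle_meet HD); apply/dual_rleP.
Qed.

Lemma is_dabs_abs f : is_dabs j (sval f) (sval (rabs dual_join f)).
Proof.
rewrite /is_dabs; have -> : (fun y => - sval f y) = sval (- f) by apply/funext => y; rewrite dualN.
exact: is_dsup_join.
Qed.

Lemma dual_pos f : rle dual_join 0 f -> posform j (sval f).
Proof. by move=> /dual_rleP h x /h. Qed.

Lemma dual_abs_ge f g x : rle dual_join (rabs dual_join f) g ->
  `|sval f x| <= sval g (rabs j x).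
Proof.
move=> fg; have h1 := rle_trans HD (rabs_ge HD f) fg.
have h2 := rle_trans HD (rabs_geN HD f) fg.
have hp y : 0 <<= y -> `|sval f y| <= sval g y.
  move=> y0; rewrite ler_norml; have /dual_rleP/(_ y y0) := h1.
  have /dual_rleP/(_ y y0) := h2; rewrite dualN; lra.
rewrite (rabsE H) (linformD (dual_lin g)) -{1}(rposB H x) (linformB (dual_lin f)).
by apply: le_trans (ler_normB _ _) _; apply: lerD; apply: hp; exact: rpos_ge0.
Qed.

Lemma dual_norm_mono f g : rle dual_join (rabs dual_join f) g -> dnorm f <= dnorm g.
Proof.
move=> fg; apply: dual_norm_le; first exact: dual_norm_ge0.
move=> x; apply: le_trans (dual_abs_ge x fg) _; apply: le_trans (ler_norm _) _.
by rewrite -[in leRHS](bl_norm_abs HF x); exact: dual_norm_bound.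
Qed.

(** [rabs dual_join f] unfolds to half of the modulus of f + f and not to [dual_modulus f]. The
    latter carries the norm bound; the least upper bound property transfers it. *)
Lemma dual_norm_abs f : dnorm (rabs dual_join f) <= dnorm f.
Proof.
have [h1 h2 _] := dual_modulusP f.
apply: dual_norm_le; first exact: dual_norm_ge0.
move=> x; apply: (@le_trans _ _ (sval (rabs dual_join f) (rabs j x))).
  by apply: dual_abs_ge; rewrite (rabs_id HD (rabs_ge0 HD f)); exact: rle_refl.
apply: (@le_trans _ _ (sval (dual_modulus f) (rabs j x))); last first.
  by apply: le_trans (ler_norm _) _; rewrite -[in leRHS](bl_norm_abs HF x).
have : dle j (sval (rabs dual_join f)) (sval (dual_modulus f)).
  apply: dual_join_lub => y y0; rewrite ?dualN; have := h1 y y0; rewrite ler_norml => /andP[]; lra.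
by apply; exact: rabs_ge0.
Qed.

(** [bidual_set] words linearity pointwise, being stated before [dualT] has operations; here it
    becomes [linform]. *)
Lemma bidual_setP (psi : dualT F -> R) : bidual_set psi <->
  linform psi /\ exists C : R, forall f, `|psi f| <= C * dnorm f.
Proof.
split=> [[lp hC]|[lp hC]]; split=> //.
  by move=> a f g; apply: lp => y; rewrite dualD dualZ.
move=> a f g h e.
have -> : h = a *: f + g by apply: dual_ext => y; rewrite e dualD dualZ.
exact: lp.
Qed.

Lemma dual_system_bidual : dual_system dual_join (@bidual_set R F).
Proof.
split.
- by move=> f /bidual_setP[].
- move=> f /bidual_setP[lf [C fC]].
  have [|g [lg pg fg gC _]] := @modulus _ _ _ HD f (fun v => `|C| * dnorm v) lf.
    move=> x v xv; apply: le_trans (fC x) _.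
    apply: (@le_trans _ _ (`|C| * dnorm x)); first by rewrite ler_wpM2r ?dual_norm_ge0 // ler_norm.
    by rewrite ler_wpM2l // dual_norm_mono.
  exists g; split=> //; apply/bidual_setP; split=> //; exists `|C| => x.
  apply: le_trans (posform_abs HD x lg pg) _; apply: le_trans (gC _ (rabs_ge0 HD x)) _.
  by rewrite ler_wpM2l // dual_norm_abs.
- move=> f g /bidual_setP[lf [C fC]] lg gf; apply/bidual_setP; split=> //; exists `|C| => x.
  apply: le_trans (gf x) _; apply: le_trans (ler_norm _) _; apply: le_trans (fC _) _.
  apply: (@le_trans _ _ (`|C| * dnorm (rabs dual_join x))).
    by rewrite ler_wpM2r ?dual_norm_ge0 // ler_norm.
  by rewrite ler_wpM2l // dual_norm_abs.
Qed.

Lemma bidual_ev (y : F) : bidual_set (fun f => sval f y).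
Proof.
apply/bidual_setP; split=> [a f g|]; first by rewrite dualD dualZ.
by exists `|y| => f; rewrite mulrC; exact: dual_norm_bound.
Qed.

(** The argument of [rwc_bounded], with evaluations at points of the unit ball of F where the
    functionals are large, in place of Hahn-Banach. *)
Lemma rwc_dual_bounded (B : set (dualT F)) : rwc_dual B ->
  exists2 C : R, 0 <= C & forall f, B f -> dnorm f <= C.
Proof.
move=> cB; apply: contrapT => /forall2NP bad.
have pick n : exists p : dualT F * F, [/\ B p.1, `|p.2| <= 1 & 2 ^+ n < `|sval p.1 p.2| ].
  apply: contrapT => /forallNP npick.
  have p2 : 0 <= 2 ^+ n :> R by rewrite exprn_ge0.
  have [//|] := bad (2 ^+ n); apply => f Bf; apply: ge_sup; first exact: (dual_norm_has_sup f).1.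
  move=> _ [x x1 <-]; rewrite leNgt; apply/negP => h.
  by apply: (npick (f, x)); split.
have [p hp] := choice pick.
pose g n f := (2 ^+ n)^-1 * sval f (p n).2.
have i2 n : 0 <= (2 ^+ n)^-1 :> R by rewrite invr_ge0 exprn_ge0.
have lg n : linform (g n).
  by move=> c f k; rewrite /g dualD dualZ; ring.
have gN n f : \sum_(i < n) `|g i f| <= 2 * dnorm f.
  apply: (@le_trans _ _ (\sum_(i < n) (2 ^+ i)^-1 * dnorm f)).
    apply: ler_sum => i _; rewrite /g normrM ger0_norm // ler_wpM2l //.
    apply: le_trans (dual_norm_bound _ _) _; rewrite ler_piMr ?dual_norm_ge0 //.
    by have [] := hp i.
  by rewrite -mulr_suml ler_wpM2r ?dual_norm_ge0 // geo_sum.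
have PhiN (h : dualT F -> R) : linform h -> (forall x, `|h x| <= 2 * dnorm x) -> bidual_set h.
  by move=> lh hh; apply/bidual_setP; split => //; exists 2.
have h0 : 0 < 2^-1 :> R by lra.
have Bp n : B (p n).1 by have [] := hp n.
have [N /(_ N (leqnn N))] := schur cB lg gN PhiN Bp h0.
rewrite /g normrM ger0_norm // ler_pdivrMl ?exprn_gt0 //; have [_ _] := hp N.
by have : 0 < 2 ^+ N :> R by [rewrite exprn_gt0]; lra.
Qed.

(** The series is summed pointwise on F and its sum is bounded by 2 C |x|, so no convergence in
    [dnorm] is involved. *)
Lemma dual_geometric_majorant (f : nat -> dualT F) (C : R) : 0 <= C ->
  (forall n, rle dual_join 0 (f n)) -> (forall n, dnorm (f n) <= C) ->
  exists h, rle dual_join 0 h /\ forall n, rle dual_join ((2 ^+ n)^-1 *: f n) h.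
Proof.
move=> C0 f0 fC; pose g n (x : F) := (2 ^+ n)^-1 * sval (f n) x.
have i2 n : 0 <= (2 ^+ n)^-1 :> R by rewrite invr_ge0 exprn_ge0.
have lg n : linform (g n) by move=> a x y; rewrite /g dual_lin; ring.
have gN n x : \sum_(i < n) `|g i x| <= 2 * C * `|x|.
  apply: (@le_trans _ _ (\sum_(i < n) (2 ^+ i)^-1 * (C * `|x|))).
    apply: ler_sum => i _; rewrite /g normrM ger0_norm // ler_wpM2l //.
    by apply: le_trans (dual_norm_bound _ _) _; rewrite ler_wpM2r.
  by rewrite -mulr_suml -mulrA ler_wpM2r ?mulr_ge0 // geo_sum.
have [h [lh hC hs]] := @linform_sums _ _ _ _ (fun=> true) lg gN.
have dh : dual_set h by apply/dual_setP; split=> //; exists (2 * C).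
have le n : rle dual_join ((2 ^+ n)^-1 *: f n) (exist _ h dh).
  apply/dual_rleP => x x0; rewrite dualZ /=.
  apply: (sums_to_ge n (hs x)) => i; rewrite /= /g mulr_ge0 //; exact: dual_pos.
exists (exist _ h dh); split=> //; apply: (rle_trans HD) (le 0%N).
exact: (rscale_ge0 HD).
Qed.

End DualLattice.

(** * The pairing of E and the dual of F *)

Section OrderBoundedDomination.
Context {R : realType} {V W : lmodType R}.
Variables (jV : V -> V -> V) (jW : W -> W -> W) (T : {linear V -> W}).
Hypotheses (HV : riesz jV) (HW : riesz jW).
Hypothesis Tob : forall v, exists w, forall z, rle jV (rabs jV z) v -> rle jW (rabs jW (T z)) w.

(** The sum of the |T x_i| is the join of the T z over all sign choices z = sum of +-x_i, and each
    such z has modulus at most the sum of the x_i. The accumulator b receives the signed terms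
    already treated, which keeps the induction in the order of F. *)
Lemma sum_abs_le (s : seq V) : (forall x, x \in s -> rle jV 0 x) -> forall b w,
  (forall z, rle jV (rabs jV z) (\sum_(x <- s) x) -> rle jW (b + T z) w) ->
  rle jW (b + \sum_(x <- s) rabs jW (T x)) w.
Proof.
elim: s => [_ b w h|x s IH s0 b w].
  have := h 0; rewrite !big_nil linear0; apply; rewrite (rabs_id HV); exact: rle_refl.
rewrite !big_cons => h.
have x0 : rle jV 0 x by apply: s0; rewrite inE eqxx.
have sp y : y \in s -> rle jV 0 y by move=> ys; apply: s0; rewrite inE ys orbT.
have absx : rle jV (rabs jV x) x by rewrite (rabs_id HV) //; exact: rle_refl.
have absxN : rle jV (rabs jV (- x)) x by rewrite (rabsN HV).
have key y : rle jV (rabs jV y) x -> rle jW (b + T y + \sum_(z <- s) rabs jW (T z)) w.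
  move=> yx; apply: IH => // z zs; rewrite -addrA -linearD; apply: h.
  by apply: (rle_trans HV (rabsD HV _ _)); exact: rleD.
have k1 := key _ absx; have := key _ absxN; rewrite linearN => k2.
set S := \sum_(z <- s) _ in k1 k2 *.
have -> : b + (rabs jW (T x) + S) = (b + S) + rabs jW (T x) by rewrite [_ + S]addrC addrA.
rewrite /rabs (rz_joinD HW); apply: (rle_join HW); rewrite addrAC //.
Qed.

(** [kantorovich] for q v = h |T v|. By [sum_abs_le] the sums over partitions of v are at most h w,
    with w a bound of |T z| for |z| <= v. *)
Lemma order_bounded_dominated h : linform h -> posform jW h ->
  exists phi, [/\ linform phi, posform jV phi &
    forall v, rle jV 0 v -> h (rabs jW (T v)) <= phi v].
Proof.
move=> lh ph; have [w hw] := choice Tob.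
have [|||phi [lphi qphi _ _]] :=
    @kantorovich _ _ jV HV (fun v => h (rabs jW (T v))) (fun v => h (w v)).
- move=> x y _ _; rewrite linearD -linformD //; apply: (posform_le HW) => //.
  exact: rabsD.
- move=> a x a0 _; rewrite -linformZ // linearZ /rabs (rz_joinZ HW) // scalerN //.
- move=> s s0; suff e : h (\sum_(x <- s) rabs jW (T x)) = \sum_(x <- s) h (rabs jW (T x)).
    rewrite -e; apply: (posform_le HW) => //; rewrite -[X in rle _ X _]add0r.
    apply: sum_abs_le => // z /hw zw; rewrite add0r.
    exact: (rle_trans HW (rabs_ge HW _)).
  elim: s {s0} => [|x s IH]; first by rewrite !big_nil linform0.
  by rewrite !big_cons linformD // IH.
exists phi; split=> // v v0; apply: le_trans (qphi v v0); apply: ph; exact: rabs_ge0.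
Qed.

End OrderBoundedDomination.

Section DisjointPairing.
Context {R : realType} {E F : completeNormedModType R}.
Variables (jE : E -> E -> E) (jF : F -> F -> F).
Hypotheses (HE : banach_lattice jE) (HF : banach_lattice jF).
Variable T : {linear E -> F}.
Hypotheses (Tob : order_bounded_op jE jF T) (Tawdp : almost_weak_DP jE jF T).
Let HEr := bl_riesz HE.
Let HFr := bl_riesz HF.
Let HD := dual_riesz HF.
Local Notation jD := (dual_join HF).

Lemma order_bounded_abs v :
  exists w, forall z, rle jE (rabs jE z) v -> rle jF (rabs jF (T z)) w.
Proof.
have [|a [b hab]] := Tob (S := [set z | rle jE (rabs jE z) v]).
  exists (- v), v => z zv; split; last exact: (rle_trans HEr (rabs_ge HEr z) zv).
  rewrite -[z]opprK; apply: (rleN HEr).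
  exact: (rle_trans HEr (rabs_geN HEr z) zv).
exists (rabs jF a + rabs jF b) => z zv.
have [|az zb] := hab (T z); first by exists z.
apply: (rabs_le HFr).
  rewrite -[T z]add0r; apply: (rleD HFr); first exact: rabs_ge0.
  exact: (rle_trans HFr zb (rabs_ge HFr b)).
rewrite -[- T z]addr0; apply: (rleD HFr); last exact: rabs_ge0.
exact: (rle_trans HFr (rleN HFr az) (rabs_geN HFr a)).
Qed.

Lemma pairing_dom_dual h : rle jD 0 h -> exists phi, dual_set phi /\
  forall r v, rle jD 0 r -> rle jD r h -> rle jE 0 v -> `|sval r (T v)| <= phi v.
Proof.
move=> h0; have [phi [lphi pphi hphi]] := order_bounded_dominated HEr HFr
  order_bounded_abs (dual_lin h) (dual_pos h0).
exists phi; split; first exact: posform_dual_set HE _ lphi pphi.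
move=> r v r0 rh v0; apply: le_trans (hphi v v0).
by apply: dual_abs_ge; rewrite (rabs_id HD).
Qed.

(** In this variable the dominating functional is explicit: evaluation at an upper bound w of |T r|
    for r in [0, z]. *)
Lemma pairing_dom z : rle jE 0 z -> exists psi, bidual_set psi /\
  forall r g, rle jE 0 r -> rle jE r z -> rle jD 0 g -> `|sval g (T r)| <= psi g.
Proof.
move=> z0; have [w hw] := order_bounded_abs z.
exists (fun f => sval f w); split; first exact: bidual_ev.
move=> r g r0 rz g0; apply: le_trans (posform_abs HFr _ (dual_lin g) (dual_pos g0)) _.
apply: (posform_le HFr (dual_lin g) (dual_pos g0)).
by apply: hw; rewrite (rabs_id HEr).
Qed.

Lemma pairing_null v g :
  (forall n, rle jE 0 (v n)) -> rdisj jE v ->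
  (forall phi, dual_set phi -> tends0 (fun n => phi (v n))) ->
  (forall n, rle jD 0 (g n)) -> rdisj jD g ->
  (forall psi, bidual_set psi -> tends0 (fun n => psi (g n))) ->
  tends0 (fun n => sval (g n) (T (v n))).
Proof.
move=> v0 vd vn g0 gd gn; apply/cvg_tends0; apply: Tawdp.
- move=> n m nm; have := vd n m nm.
  by rewrite -{1}(rabs_id HEr (v0 n)) -{1}(rabs_id HEr (v0 m)).
- by move=> phi /vn /cvg_tends0.
- move=> n m nm; exists (sval (rabs jD (g n))), (sval (rabs jD (g m))).
  split; first exact: is_dabs_abs.
  split; first exact: is_dabs_abs.
  by have := is_dinf_meet HF (g n) (g m); rewrite gd // !(rabs_id HD).
- by move=> psi /gn /cvg_tends0.
Qed.

Lemma rwc_majorant (A : set E) : rwc_E A -> forall a, (forall n : nat, A (a n)) ->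
  exists y, rle jE 0 y /\ forall n, rle jE ((2 ^+ n)^-1 *: rabs jE (a n)) y.
Proof.
move=> /rwc_bounded[C AC] a Aa; apply: (geometric_majorant HE (C := C)) => n.
  exact: rabs_ge0.
by rewrite (bl_norm_abs HE); exact: AC.
Qed.

Lemma rwc_dual_majorant (B : set (dualT F)) : rwc_dual B ->
  forall b, (forall n : nat, B (b n)) ->
  exists y, rle jD 0 y /\ forall n, rle jD ((2 ^+ n)^-1 *: rabs jD (b n)) y.
Proof.
move=> /rwc_dual_bounded[C C0 BC] b Bb.
apply: (dual_geometric_majorant (C := C)) => // n; first exact: rabs_ge0.
by apply: le_trans (dual_norm_abs HF _) _; exact: BC.
Qed.

End DisjointPairing.

Theorem theorem2p5 (R : realType) (E F : completeNormedModType R)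
  (jE : E -> E -> E) (jF : F -> F -> F)
  (HE : banach_lattice jE) (HF : banach_lattice jF)
  (T : {linear E -> F}) (Tcont : continuous T)
  (Tob : order_bounded_op jE jF T) (Tawdp : almost_weak_DP jE jF T) :
  (forall (A : set E) (B : set (dualT F)) (eps : R),
     rwc_E A -> rwc_dual B -> 0 < eps ->
     exists u : E, vle jE 0 u /\
       forall x f, A x -> B f ->
         exists a, is_dabs jF (sval f) a /\
           a (T (vpos jE (vabs jE x - u))) <= eps) /\
  (forall (A : set E) (B : set (dualT F)) (eps : R),
     rwc_E A -> rwc_dual B -> 0 < eps ->
     exists g : dualT F, dle jF (fun _ => 0) (sval g) /\
       forall x f, A x -> B f ->
         exists a b, is_dabs jF (sval f) a /\
           is_dsup jF (fun y => a y - sval g y) (fun _ => 0) b /\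
           b (T (vabs jE x)) <= eps).
Proof.
have HEr := bl_riesz HE; have HD := dual_riesz HF.
have DSE := dual_system_dual_set HE; have DSD := dual_system_bidual HF.
have lin1 (f : dualT F) : linform (fun x => sval f (T x)).
  by move=> a x y; rewrite linearP; exact: dual_lin.
have lin2 (x : E) : linform (fun f : dualT F => sval f (T x)).
  by move=> a f g; rewrite dualD dualZ.
split=> A B e cA cB e0.
- have [u [u0 hu]] := @bilinear_approx _ _ _ _ _ _ _ (fun x (f : dualT F) => sval f (T x))
    HEr HD DSE DSD lin1 lin2 (pairing_dom_dual HE Tob) (pairing_dom HE HF Tob)
    (pairing_null HE Tawdp) _ _ _ cA cB (rwc_majorant HE cA) (rwc_dual_majorant HF cB) e0.
  exists u; split=> // x f Ax Bf; exists (sval (rabs (dual_join HF) f)).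
  by split; [exact: is_dabs_abs|exact: hu].
- have [|||u [u0 hu]] := @bilinear_approx _ _ _ _ _ _ _ (fun (f : dualT F) x => sval f (T x))
    HD HEr DSD DSE lin2 lin1 _ _ _ _ _ _ cB cA (rwc_dual_majorant HF cB) (rwc_majorant HE cA) e0.
  + move=> z z0; have [psi [Ppsi h]] := pairing_dom HE HF Tob z0.
    by exists psi; split=> // r v r0 rz v0; exact: h.
  + move=> h h0; have [phi [Pphi hh]] := pairing_dom_dual HE Tob h0.
    by exists phi; split=> // r v r0 rz v0; exact: hh.
  + move=> g v g0 gd gn v0 vd vn; exact: (pairing_null HE Tawdp v0 vd vn g0 gd gn).
  exists u; split; first by move=> y; have /dual_rleP/(_ y) := u0.
  move=> x f Ax Bf; exists (sval (rabs (dual_join HF) f)).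
  exists (sval (rpos (dual_join HF) (rabs (dual_join HF) f - u))).
  split; first exact: is_dabs_abs.
  split; last exact: hu.
  have -> : (fun y => sval (rabs (dual_join HF) f) y - sval u y) =
            sval (rabs (dual_join HF) f - u) by apply/funext => y; rewrite dualD dualN.
  exact: is_dsup_join.
Qed.
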